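(* Let $A=(a_{ij})_{n\times n}\in\mathrm{End}(\mathbb{Z}^n)$ with $\det(A)\neq0$ and $\bigcap_{k=1}^{\infty}\mathrm{im}\,A^k=0$. Let $R$ be a commutative Noetherian ring and $S=R[t_1^{\pm1},\dots,t_n^{\pm1}]$, where $t_1,\dots,t_n$ are indeterminates. Suppose $\phi\colon S\to S$ is a ring monomorphism such that $\phi(R)=R$ and, for all $j$, $\phi(t_j)=g_j\prod_{i=1}^{n}t_i^{a_{ij}}$, where the $g_j$ are units of $R$. Let $\mathfrak{M}$ be a finite $S$-module. Suppose there exists a group isomorphism $\eta\colon\mathfrak{M}\to\mathfrak{M}$ such that $\eta(sx)=\phi(s)\eta(x)$ for all $s\in S$ and all $x\in\mathfrak{M}$. Then $\mathfrak{M}$ is a finite $R$-module.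
   Context: A finite module is a finitely generated module. Elements of $\mathbb{Z}^n$ are column vectors and $A$ acts on $\mathbb{Z}^n$ by left multiplication. *)

(* Defs.v *)
From HB Require Import structures.
From mathcomp Require Import all_boot all_order all_algebra finmap.
From mathcomp.multinomials Require Import monalg.

Set Implicit Arguments.
Unset Strict Implicit.
Unset Printing Implicit Defensive.

Import GRing.Theory.
Local Open Scope fset_scope.
Local Open Scope ring_scope.

(* R[t_1^{+-1}, ..., t_n^{+-1}] is the group ring of Z^n over R: finitely
   supported families of coefficients in R indexed by exponent vectors, with
   convolution as product. The ring structure that monalg puts on {malg R[K]}
   cannot be reused, because a monomType has no invertible element but 1. *)
Definition laurent (n : nat) (R : comPzRingType) := {malg R['cV[int]_n]}.

Section LaurentRing.
Variables (n : nat) (R : comPzRingType).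
Local Notation S := (laurent n R).
Implicit Types (p q : S) (u v : 'cV[int]_n) (a b : R).

HB.instance Definition _ := GRing.Zmodule.on S.

Definition lmonom a u : S := mkmalgU u a.

Definition lmul p q : S :=
  \sum_(u <- msupp p) \sum_(v <- msupp q)
    lmonom (mcoeff u p * mcoeff v q) (u + v).

Definition lone : S := lmonom 1 0.

Fact lmonomB u : {morph lmonom^~ u : a b / a - b}.
Proof. by move=> a b; exact: monalgU_is_additive. Qed.
Fact lmonom0 u : lmonom 0 u = 0.
Proof. exact: monalgU0. Qed.
Fact lmonomD u : {morph lmonom^~ u : a b / a + b}.
Proof. by move=> a b; exact: monalgUD. Qed.

Fact lmulw (d e : {fset 'cV[int]_n}) p q :
  msupp p `<=` d -> msupp q `<=` e ->
  lmul p q = \sum_(u <- d) \sum_(v <- e)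
    lmonom (mcoeff u p * mcoeff v q) (u + v).
Proof.
move=> sd se; rewrite /lmul (big_fset_incl _ sd) /=; last first.
  move=> u _ up; rewrite big1 // => v _.
  by rewrite (mcoeff_outdom up) mul0r lmonom0.
apply: eq_bigr => u _; rewrite (big_fset_incl _ se) //= => v _ vq.
by rewrite (mcoeff_outdom vq) mulr0 lmonom0.
Qed.

Fact lmulC : commutative lmul.
Proof.
move=> p q; rewrite /lmul exchange_big /=.
by apply: eq_bigr => v _; apply: eq_bigr => u _; rewrite mulrC addrC.
Qed.

Fact lmulDl : left_distributive lmul +%R.
Proof.
move=> p1 p2 q; pose d := msupp p1 `|` msupp p2.
rewrite (lmulw (d := d) (p := p1 + p2) (msuppD_le _ _) (fsubset_refl _)).
rewrite (lmulw (d := d) (p := p1) (fsubsetUl _ _) (fsubset_refl _)).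
rewrite (lmulw (d := d) (p := p2) (fsubsetUr _ _) (fsubset_refl _)).
rewrite -big_split; apply: eq_bigr => u _; rewrite -big_split.
by apply: eq_bigr => v _ /=; rewrite -lmonomD -mulrDl mcoeffD.
Qed.

Fact lmulDr : right_distributive lmul +%R.
Proof. by move=> p q r; rewrite lmulC lmulDl !(lmulC p). Qed.

Fact lmulMM a b u v :
  lmul (lmonom a u) (lmonom b v) = lmonom (a * b) (u + v).
Proof.
rewrite (lmulw (d := [fset u]) (e := [fset v]) msuppU_le msuppU_le).
by rewrite !big_seq_fset1 !mcoeffUU.
Qed.

Fact lmul0r q : lmul 0 q = 0.
Proof. by rewrite /lmul msupp0 big_seq_fset0. Qed.

Fact lmul_suml (I : Type) (s : seq I) (F : I -> S) q :
  lmul (\sum_(i <- s) F i) q = \sum_(i <- s) lmul (F i) q.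
Proof. by apply: (big_morph (lmul^~ q)) => [x y|]; rewrite ?lmulDl ?lmul0r. Qed.

Fact lmul_sumr (I : Type) (s : seq I) (F : I -> S) q :
  lmul q (\sum_(i <- s) F i) = \sum_(i <- s) lmul q (F i).
Proof. by rewrite lmulC lmul_suml; apply: eq_bigr => i _; rewrite lmulC. Qed.

Fact laurentE p : p = \sum_(u <- msupp p) lmonom (mcoeff u p) u.
Proof. exact: monalgE. Qed.

Fact lmulA : associative lmul.
Proof.
move=> p q r; rewrite (laurentE p) !lmul_suml; apply: eq_bigr => u _.
set x := lmonom _ u.
rewrite (laurentE q) lmul_suml !lmul_sumr lmul_suml; apply: eq_bigr => v _.
rewrite (laurentE r) !lmul_sumr; apply: eq_bigr => w _.
by rewrite !lmulMM mulrA addrA.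
Qed.

Fact lmul1 : left_id lone lmul.
Proof.
move=> p; rewrite (laurentE p) lmul_sumr; apply: eq_bigr => u _.
by rewrite lmulMM mul1r add0r.
Qed.

HB.instance Definition _ :=
  GRing.Zmodule_isComPzRing.Build S lmulA lmulC lmul1 lmulDl.

Definition laurentC a : S := lmonom a 0.

Fact laurentC_is_additive : zmod_morphism laurentC.
Proof. exact: lmonomB. Qed.

Fact laurentC_is_multiplicative : monoid_morphism laurentC.
Proof. by split=> // a b; rewrite [RHS]lmulMM addr0. Qed.

HB.instance Definition _ :=
  GRing.isZmodMorphism.Build R S laurentC laurentC_is_additive.
HB.instance Definition _ :=
  GRing.isMonoidMorphism.Build R S laurentC laurentC_is_multiplicative.

(* The integer power t_i ^ z, i.e. the monomial with exponent vector z e_i;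
   laurentXD, laurentX0 and laurentXn below show that z |-> laurentX i z is
   indeed the group of powers of t_i = laurentX i 1. *)
Definition laurentX (i : 'I_n) (z : int) : S :=
  lmonom 1 (z *: delta_mx i 0).

Lemma laurentX0 i : laurentX i 0 = 1.
Proof. by rewrite /laurentX scale0r. Qed.

Lemma laurentXD i (y z : int) :
  laurentX i (y + z) = laurentX i y * laurentX i z.
Proof. by rewrite [RHS]lmulMM mulr1 -scalerDl. Qed.

Lemma laurentXn i (k : nat) : laurentX i k%:Z = laurentX i 1 ^+ k.
Proof.
elim: k => [|k IHk]; first exact: laurentX0.
by rewrite intS laurentXD IHk exprS.
Qed.

Lemma laurentXV i (z : int) : laurentX i z * laurentX i (- z) = 1.
Proof. by rewrite -laurentXD subrr laurentX0. Qed.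

End LaurentRing.

Arguments laurentC {n R} a.
Arguments laurentX {n R} i z.

Definition is_unit (R : comPzRingType) (a : R) : Prop :=
  exists b : R, a * b = 1.

Definition is_ideal (R : comPzRingType) (I : R -> Prop) : Prop :=
  [/\ I 0, forall a b, I a -> I b -> I (a + b)
    & forall r a, I a -> I (r * a)].

Definition noetherian (R : comPzRingType) : Prop :=
  forall I : R -> Prop, is_ideal I ->
  exists (m : nat) (e : 'I_m -> R), forall x : R,
    I x <-> exists c : 'I_m -> R, x = \sum_(i < m) c i * e i.

Definition finite_module (R : pzRingType) (M : lmodType R) : Prop :=
  exists (m : nat) (e : 'I_m -> M), forall x : M,
    exists c : 'I_m -> R, x = \sum_(i < m) c i *: e i.

Definition restrict_scalars (R S : pzRingType) (f : {rmorphism R -> S})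
  (M : lmodType S) : Type := M.

Section RestrictScalars.
Variables (R S : pzRingType) (f : {rmorphism R -> S}) (M : lmodType S).
Local Notation N := (restrict_scalars f M).

HB.instance Definition _ := GRing.Zmodule.on N.

Definition rscale (r : R) (x : N) : N := f r *: (x : M).

Fact rscaleA a b x : rscale a (rscale b x) = rscale (a * b) x.
Proof. by rewrite /rscale scalerA rmorphM. Qed.
Fact rscale1 : left_id 1 rscale.
Proof. by move=> x; rewrite /rscale rmorph1 scale1r. Qed.
Fact rscaleDr : right_distributive rscale +%R.
Proof. by move=> a x y; exact: scalerDr. Qed.
Fact rscaleDl x : {morph rscale^~ x : a b / a + b}.
Proof. by move=> a b; rewrite /rscale rmorphD scalerDl. Qed.

HB.instance Definition _ :=
  GRing.Zmodule_isLmodule.Build R N rscaleA rscale1 rscaleDr rscaleDl.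

End RestrictScalars.

(* Main.v *)
Require Import Defs.
From HB Require Import structures.
From mathcomp Require Import all_boot all_order all_algebra.
From mathcomp Require Import boolp classical_sets ring zify.

(** Let [S] be the Laurent polynomial ring, [I] the annihilator of the module
    and [D] the quotient of [S] by [I], which acts faithfully.

    The maps [eta^-j s eta^j], for [s] in [S], form an increasing chain of
    [S]-submodules of the endomorphisms of the module, because
    [eta^-j s eta^j = eta^-(j+1) (phi s) eta^(j+1)].  The module is Noetherian,
    so the chain stops, and this says that [phi] induces a surjection of [D]
    onto itself ([semilinear_surjective]); it is injective since [eta] is.
    Let [psi] be its inverse.  The units [psi^k (t^v)] of [D] then exist for
    every [k], and [psi^k (t^v)] and [psi^(k+1) (t^(A v))] differ by a unit of
    the image of [R].

    Suppose that [D] is not a finite module over the image of [R].  Then some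
    map [v] from the units of [D] to the integers turns products into sums,
    vanishes on the units of [R] and not on all the [t_j]
    ([exists_discrete_valuation]).
    The integer row vectors [x_k = (v (psi^k t_j))_j] satisfy
    [x_(k+1) A = x_k] and [x_0 <> 0].  The lattice of integer vectors is
    Noetherian, so some [x_K] is a combination of the previous ones; multiplied
    by [A^K] this becomes [x_0 (1 - A s) = 0] for a polynomial [s] in [A].
    Hence [1 - A s] is singular and has a nonzero column [w] in its kernel, and
    [w = A s w] lies in the image of every power of [A], which is excluded
    ([no_infinite_division]).  So [D], and with it the module, is finite over
    [R].

    It remains to find [v].  If [D] is not finite over a subring [B], a maximal
    subring [O] above [B] over which [D] is not finite contains each unit of [D]
    or its inverse ([exists_valuation_subring]).  For [B] the image of [R] this
    singles out the [t] among the [t_j] and their inverses of greatest value;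
    it yields a finitely generated, hence Noetherian, subring [B'] with
    [D = B'[1/t]] and [1/t] not in [B'].  Localise [B'] at a prime that is
    minimal over [t], so that [B'/t] gets finite length [e], and take a maximal
    subring [O] for the localised ring.  As in the theorem of Krull and Akizuki,
    a chain of submodules between [t O] and [O] has at most [e] steps, although
    [O] need not be finite over [B'] ([chain_bound]).  The value group, the units
    of [D] modulo those of [O], is thus totally ordered with only finitely many
    values between zero and that of [t]: it is infinite cyclic
    ([exists_valuation]).

    The localisation is never formed.  A multiplicative set [E] of [B'], maximal
    among those disjoint from [t B'], plays the role of the complement of the
    prime, and submodules of [D] are compared after saturation by [E]. *)

Set Implicit Arguments.
Unset Strict Implicit.
Unset Printing Implicit Defensive.

Import GRing.Theory.
Local Open Scope ring_scope.

(** * Uniform bounds and maximal sets *)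

Lemma uniform_bound (T : eqType) (s : seq T) (P : nat -> T -> Prop) :
  (forall i j x, (i <= j)%N -> P i x -> P j x) ->
  (forall x, x \in s -> exists i, P i x) ->
  exists i, forall x, x \in s -> P i x.
Proof.
move=> Pmono; elim: s => [|y s IHs] exP; first by exists 0%N.
have [i Pi] := IHs (fun x xs => exP x (mem_behead (s := y :: s) xs)).
have [j Pj] := exP y (mem_head y s).
exists (maxn i j) => x; rewrite inE => /predU1P[->|xs].
  exact: Pmono (leq_maxr _ _) Pj.
exact: Pmono (leq_maxl _ _) (Pi x xs).
Qed.

(** Zorn's lemma for families of nonempty sets, where only the unions of nonempty
    chains have to be examined. *)
Lemma exists_maximal_set (T : Type) (good : set T -> Prop) :
  (forall X, good X -> exists x, X x) -> (exists X, good X) ->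
  (forall F : set (set T), (forall X, F X -> good X) -> (exists X, F X) ->
     total_on F subset -> good (\bigcup_(X in F) X)%classic) ->
  exists A, good A /\
    forall A', good A' -> (forall x, A x -> A' x) -> forall x, A' x -> A x.
Proof.
move=> good_ex [X0 gX0] gU.
(* the empty set is admitted so that the empty chain has an upper bound *)
have [F FP Ftot|A [[A0|gA] maxA]] := @Zorn_bigcup T (fun X => X = set0 \/ good X).
- pose F1 X := F X /\ good X.
  have FF1 : (\bigcup_(X in F) X = \bigcup_(X in F1) X)%classic.
    apply/seteqP; split=> x [X FX Xx]; last by exists X => //; case: FX.
    by exists X => //; split=> //; case: (FP X FX) => // X0'; rewrite X0' in Xx.
  have [exF1|nF1] := pselect (exists X, F1 X).
    right; rewrite FF1; apply: gU => // [X [] //|X Y [FX _] [FY _]].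
    exact: Ftot.
  by left; rewrite FF1; apply/seteqP; split=> // x [X F1X _]; case: nF1; exists X.
- have [x X0x] := good_ex X0 gX0.
  by case: (maxA X0); [rewrite A0; split=> // /(_ x X0x)|right].
exists A; split=> // A' gA' AA' x A'x; apply: contrapT => nAx.
by case: (maxA A'); [split=> // /(_ x A'x)|right].
Qed.

Lemma chain_union2 (T : Type) (F : set (set T)) X Y x y :
  total_on F subset -> F X -> F Y -> X x -> Y y -> exists Z, [/\ F Z, Z x & Z y].
Proof.
move=> Ftot FX FY Xx Yy; have [XY|YX] := Ftot X Y FX FY.
  by exists Y; split=> //; apply: XY.
by exists X; split=> //; apply: YX.
Qed.

(** * Noetherian subrings and the Hilbert basis theorem *)

Section Subrings.
Variable D : comPzRingType.
Implicit Types (B N X : D -> Prop) (s : seq D).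

Definition subring B : Prop :=
  [/\ B 1, forall x y, B x -> B y -> B (x - y)
    & forall x y, B x -> B y -> B (x * y)].

Definition submod B N : Prop :=
  [/\ N 0, forall x y, N x -> N y -> N (x + y)
    & forall b x, B b -> N x -> N (b * x)].

(** Defined as an intersection so that an inclusion into a submodule is proved on
    the generators alone, with no coefficients to manage. *)
Definition span B s : D -> Prop :=
  fun x => forall N, submod B N -> {in s, forall y, N y} -> N x.

Definition noeth_subring B : Prop :=
  forall N, submod B N -> (forall x, N x -> B x) ->
  exists s, {in s, forall y, N y} /\ forall x, N x -> span B s x.

Lemma subring1 B : subring B -> B 1. Proof. by case. Qed.

Lemma subring0 B : subring B -> B 0.
Proof. by case=> B1 BB _; rewrite -(subrr 1); apply: BB. Qed.

Lemma subringN B x : subring B -> B x -> B (- x).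
Proof.
move=> sB Bx; rewrite -sub0r; case: (sB) => _ + _; apply => //.
exact: subring0.
Qed.

Lemma subringD B x y : subring B -> B x -> B y -> B (x + y).
Proof.
move=> sB Bx By; rewrite -[y]opprK; case: (sB) => _ + _; apply => //.
exact: subringN.
Qed.

Lemma subringM B x y : subring B -> B x -> B y -> B (x * y).
Proof. by case=> _ _; apply. Qed.

Lemma subringX B x k : subring B -> B x -> B (x ^+ k).
Proof.
move=> sB Bx; elim: k => [|k IH]; first by rewrite expr0; apply: subring1.
by rewrite exprS; apply: subringM.
Qed.

Lemma submod_self B : subring B -> submod B B.
Proof.
move=> sB; split; first exact: subring0.
  by move=> x y; apply: subringD.
by move=> x y; apply: subringM.
Qed.

Lemma submodN B N x : subring B -> submod B N -> N x -> N (- x).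
Proof.
move=> sB [_ _ NM] Nx; rewrite -mulN1r; apply: NM => //.
by apply: subringN => //; apply: subring1.
Qed.

Lemma submodB B N x y : subring B -> submod B N -> N x -> N y -> N (x - y).
Proof.
move=> sB sN Nx Ny; case: (sN) => _ ND _; apply: ND => //.
exact: submodN sN Ny.
Qed.

Lemma submod_premul B N a : submod B N -> submod B (fun x => N (a * x)).
Proof.
move=> [N0 ND NM]; split=> [|x y Nx Ny|b x Bb Nx]; first by rewrite mulr0.
  by rewrite mulrDr; apply: ND.
by rewrite mulrCA; apply: NM.
Qed.

Lemma submod_postmul B N a : submod B N -> submod B (fun x => N (x * a)).
Proof.
move=> [N0 ND NM]; split=> [|x y Nx Ny|b x Bb Nx]; first by rewrite mul0r.
  by rewrite mulrDl; apply: ND.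
by rewrite -mulrA; apply: NM.
Qed.

Lemma span_submod B s : submod B (span B s).
Proof.
split=> [N [] //|x y Nx Ny N sN Ns|b x Bb Nx N sN Ns].
  by case: (sN) => _ ND _; apply: ND; [apply: Nx|apply: Ny].
by case: (sN) => _ _; apply => //; apply: Nx.
Qed.

Lemma span_mem B s x : x \in s -> span B s x.
Proof. by move=> xs N _; apply. Qed.

Lemma span_min B s N :
  submod B N -> {in s, forall y, N y} -> forall x, span B s x -> N x.
Proof. by move=> sN Ns x; apply. Qed.

Lemma noeth_chain B (N : nat -> D -> Prop) : subring B -> noeth_subring B ->
  (forall i, submod B (N i)) -> (forall i x, N i x -> B x) ->
  (forall i x, N i x -> N i.+1 x) ->
  exists m, forall i x, N i x -> N m x.
Proof.
move=> sB nB sN NB Nup.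
have Nmono i j x : (i <= j)%N -> N i x -> N j x.
  move=> /subnKC <-; elim: (j - i)%N => [|k IH]; rewrite ?addn0 // addnS.
  by move=> /IH/Nup.
have sU : submod B (fun x => exists i, N i x).
  split=> [|x y [i Nx] [j Ny]|b x Bb [i Nx]].
  - by exists 0%N; case: (sN 0%N).
  - exists (maxn i j); case: (sN (maxn i j)) => _ ND _; apply: ND.
      exact: Nmono (leq_maxl _ _) Nx.
    exact: Nmono (leq_maxr _ _) Ny.
  - by exists i; case: (sN i) => _ _; apply.
have [|s [sU' gU]] := nB _ sU; first by move=> x [i /NB].
have [m Nm] := uniform_bound (fun i j x => @Nmono i j x) sU'.
by exists m => i x Nx; apply: (gU x) => //; exists i.
Qed.

(** Polynomial expressions in [a] of degree less than [d] with coefficients in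
    [V].  They are built by recursion on the degree because an element may have
    several such expressions: a leading coefficient belongs to a given one. *)
Fixpoint lower_terms V a d : D -> Prop :=
  if d is d'.+1 then
    fun x => exists2 c, V c & lower_terms V a d' (x - a ^+ d' * c)
  else fun x => x = 0.

Definition adjoin V a : D -> Prop := fun x => exists d, lower_terms V a d x.

Section LowerTerms.
Variables (B V : D -> Prop) (a : D).
Hypothesis sV : submod B V.

Lemma lower_terms_submod d : submod B (lower_terms V a d).
Proof.
elim: d => [|d IH] /=.
  by split=> [//|x y -> ->|b x _ ->]; rewrite ?addr0 ?mulr0.
case: sV => V0 VD VM; case: IH => I0 ID IM; split.
- by exists 0 => //; rewrite mulr0 subr0.
- move=> x y [c Vc lx] [c' Vc' ly]; exists (c + c'); first exact: VD.
  have -> : x + y - a ^+ d * (c + c') =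
      (x - a ^+ d * c) + (y - a ^+ d * c') by ring.
  exact: ID.
move=> b x Bb [c Vc lx]; exists (b * c); first exact: VM.
have -> : b * x - a ^+ d * (b * c) = b * (x - a ^+ d * c) by ring.
exact: IM.
Qed.

Lemma lower_terms_mono d e x : (d <= e)%N -> lower_terms V a d x -> lower_terms V a e x.
Proof.
move=> /subnKC <-; elim: (e - d)%N => [|k IH]; rewrite ?addn0 // => lx.
rewrite addnS /=; exists 0; first by case: sV.
by rewrite mulr0 subr0; apply: IH.
Qed.

Lemma lower_terms_monom d i c : (i < d)%N -> V c -> lower_terms V a d (a ^+ i * c).
Proof.
move=> lid Vc; apply: lower_terms_mono lid _ => /=.
by exists c; rewrite ?subrr //; case: (lower_terms_submod i).
Qed.

Lemma lower_terms_mulX d x : lower_terms V a d x -> lower_terms V a d.+1 (a * x).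
Proof.
elim: d x => [|d IH] x /= => [->|[c Vc /IH lx]].
  by exists 0; rewrite ?mulr0 ?subr0 //; case: sV.
exists c => //; suff -> : a * x - a ^+ d.+1 * c = a * (x - a ^+ d * c) by [].
by rewrite exprS; ring.
Qed.

Lemma adjoin_submod : submod B (adjoin V a).
Proof.
split=> [|x y [d lx] [e ly]|b x Bb [d lx]].
- by exists 0%N.
- exists (maxn d e); case: (lower_terms_submod (maxn d e)) => _ ID _; apply: ID.
    exact: lower_terms_mono (leq_maxl _ _) lx.
  exact: lower_terms_mono (leq_maxr _ _) ly.
- by exists d; case: (lower_terms_submod d) => _ _; apply.
Qed.

Lemma adjoin_mulX k x : adjoin V a x -> adjoin V a (a ^+ k * x).
Proof.
elim: k x => [|k IH] x; first by rewrite mul1r.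
by case=> d /lower_terms_mulX lx; rewrite exprSr -mulrA; apply: IH; exists d.+1.
Qed.

Lemma adjoin_sub x : V x -> adjoin V a x.
Proof.
by move=> Vx; exists 1%N; rewrite -[x]mul1r -(expr0 a); apply: lower_terms_monom.
Qed.

Lemma adjoin_min N : submod B N -> (forall x, V x -> N x) ->
  (forall x, N x -> N (a * x)) -> forall x, adjoin V a x -> N x.
Proof.
move=> [N0 ND NM] VN aN x [d]; elim: d x => [|d IH] x /= => [->//|[c Vc lx]].
rewrite -(subrK (a ^+ d * c) x); apply: ND; first exact: IH.
elim: d {lx IH x} => [|d IH]; first by rewrite mul1r; apply: VN.
by rewrite exprS -mulrA; apply: aN.
Qed.
End LowerTerms.

Section Adjoin.
Variables (B : D -> Prop) (a : D).
Hypothesis sB : subring B.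
Let sBB : submod B B := submod_self sB.

Lemma adjoin_gen : adjoin B a a.
Proof.
have := adjoin_mulX sBB 1 (adjoin_sub a sBB (subring1 sB)).
by rewrite expr1 mulr1.
Qed.

Lemma adjoin_subring : subring (adjoin B a).
Proof.
have sA := adjoin_submod a sBB; split.
- exact: (adjoin_sub a sBB (subring1 sB)).
- by move=> x y; apply: submodB sA.
move=> x y Ax Ay; move: x Ax; apply: (adjoin_min (B := B)).
- exact: submod_postmul.
- by move=> b Bb; case: sA => _ _; apply.
by move=> x Axy; rewrite -mulrA; have := adjoin_mulX sBB 1 Axy; rewrite expr1.
Qed.

Lemma adjoin_minr C : subring C -> (forall x, B x -> C x) -> C a ->
  forall x, adjoin B a x -> C x.
Proof.
move=> sC BC Ca; apply: (adjoin_min (B := B)) => //; last by move=> x; apply: subringM.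
by case: (submod_self sC) => C0 CD CM; split=> // b x /BC; apply: CM.
Qed.
End Adjoin.

(** Hilbert's argument: the leading coefficients in degree [d] of the elements of an
    ideal form an ideal [L d] of [B], these increase with [d] and so stop at some
    [d0].  Elements of the ideal that realise generators of the [L d] for [d <= d0]
    reduce the degree of any other element. *)
Lemma hilbert_basis B a :
  subring B -> noeth_subring B -> noeth_subring (adjoin B a).
Proof.
move=> sB nB N sN NA; have sBB := submod_self sB.
have sA := adjoin_subring a sB.
have BA x : B x -> adjoin B a x by apply: (adjoin_sub a sBB).
have Aa := adjoin_gen a sB.
pose L d c := B c /\ exists2 y, N y & lower_terms B a d (y - a ^+ d * c).
have sL d : submod B (L d).
  have [l0 lD lM] := lower_terms_submod a sBB d.
  case: sN => N0 ND NM; split.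
  - split; first exact: subring0.
    by exists 0; rewrite ?mulr0 ?subr0.
  - move=> c c' [Bc [y Ny ly]] [Bc' [y' Ny' ly']]; split; first exact: subringD.
    exists (y + y'); first exact: ND.
    have -> : y + y' - a ^+ d * (c + c') =
        (y - a ^+ d * c) + (y' - a ^+ d * c') by ring.
    exact: lD.
  move=> b c Bb [Bc [y Ny ly]]; split; first exact: subringM.
  exists (b * y); first by apply: NM => //; apply: BA.
  have -> : b * y - a ^+ d * (b * c) = b * (y - a ^+ d * c) by ring.
  exact: lM.
have Lup d c : L d c -> L d.+1 c.
  case=> Bc [y Ny ly]; split=> //; exists (a * y).
    by case: sN => _ _; apply.
  have -> : a * y - a ^+ d.+1 * c = a * (y - a ^+ d * c) by rewrite exprS; ring.
  exact: (lower_terms_mulX sBB).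
have [d0 Ld0] := noeth_chain sB nB sL (fun d c Lc => Lc.1) Lup.
have exg d : exists s, {in s, forall c, L d c} /\ forall c, L d c -> span B s c.
  by apply: nB => // c [].
have [g /all_and2[gL Lg]] := choice exg.
have exf d : exists f : D -> D,
    forall c, L d c -> N (f c) /\ lower_terms B a d (f c - a ^+ d * c).
  have /choice[f fP] : forall c, exists y,
      L d c -> N y /\ lower_terms B a d (y - a ^+ d * c).
    move=> c; have [[_ [y Ny ly]]|nL] := pselect (L d c); first by exists y.
    by exists 0 => /nL.
  by exists f.
have [f fP] := choice exf.
exists (flatten [seq [seq f d c | c <- g d] | d <- iota 0 d0.+1]); split.
  move=> _ /flattenP[_ /mapP[d _ ->] /mapP[c cg ->]].
  by have [] := fP d c (gL d c cg).
set gens := flatten _.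
suff main d x : N x -> lower_terms B a d x -> span (adjoin B a) gens x.
  by move=> x Nx; have [d lx] := NA x Nx; apply: main lx.
have sS := span_submod (adjoin B a) gens.
elim: d x => [|d IH] x Nx /= => [->|[c Bc lx]]; first by case: sS.
suff [y [Ny Sy ly]] :
    exists y, [/\ N y, span (adjoin B a) gens y & lower_terms B a d (y - a ^+ d * c)].
  rewrite -(subrK y x); case: (sS) => _ SD _; apply: SD => //; apply: IH.
    exact: submodB sN Nx Ny.
  have -> : x - y = (x - a ^+ d * c) - (y - a ^+ d * c) by ring.
  exact: submodB (lower_terms_submod a sBB d) lx ly.
(* c is a leading coefficient in degree d, hence also in degree e, since the
   ideals L d stop growing at d0; there it is a combination of the chosen
   generators, and a ^ (d - e) brings the result back to degree d *)
have Ldc : L d c by split=> //; exists x.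
pose e := minn d d0.
have Lec : L e c by rewrite /e /minn; case: ifP => // _; apply: Ld0 Ldc.
suff [y [Ny Sy ly]] :
    exists y, [/\ N y, span (adjoin B a) gens y & lower_terms B a e (y - a ^+ e * c)].
  exists (a ^+ (d - e) * y); split.
  - by case: sN => _ _; apply => //; apply: subringX.
  - by case: sS => _ _; apply => //; apply: subringX.
  have led : (e <= d)%N by apply: geq_minl.
  rewrite -{1 3}(subnK led); elim: (d - e)%N => [|k IHk].
    by rewrite expr0 mul1r.
  rewrite addSn.
  have -> : a ^+ k.+1 * y - a ^+ (k + e).+1 * c =
      a * (a ^+ k * y - a ^+ (k + e) * c).
    by rewrite !exprS; ring.
  exact: (lower_terms_mulX sBB).
pose P c := exists y,
  [/\ N y, span (adjoin B a) gens y & lower_terms B a e (y - a ^+ e * c)].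
suff: P c by [].
apply: (span_min _ _ (Lg e c Lec)).
  have [l0 lD lM] := lower_terms_submod a sBB e.
  case: sN sS => N0 ND NM [S0 SD SM]; split.
  - by exists 0; split=> //; rewrite mulr0 subr0.
  - move=> u v [y [Ny Sy ly]] [z [Nz Sz lz]]; exists (y + z).
    split; [exact: ND|exact: SD|].
    have -> : y + z - a ^+ e * (u + v) =
        (y - a ^+ e * u) + (z - a ^+ e * v) by ring.
    exact: lD.
  move=> b u Bb [y [Ny Sy ly]]; exists (b * y); split.
  - by apply: NM => //; apply: BA.
  - by apply: SM => //; apply: BA.
  have -> : b * y - a ^+ e * (b * u) = b * (y - a ^+ e * u) by ring.
  exact: lM.
move=> u ug; have [Nf lf] := fP e u (gL e u ug).
exists (f e u); split=> //; apply: span_mem.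
apply/flattenP; exists [seq f e c | c <- g e]; last exact: map_f.
by apply/mapP; exists e; rewrite // mem_iota add0n ltnS geq_minr.
Qed.

Definition algebra B s : D -> Prop := foldr (fun a C => adjoin C a) B s.

Lemma algebra_subring B s : subring B -> subring (algebra B s).
Proof. by move=> sB; elim: s => //= a s; apply: adjoin_subring. Qed.

Lemma algebra_noeth B s : subring B -> noeth_subring B -> noeth_subring (algebra B s).
Proof.
move=> sB nB; elim: s => //= a s; apply: hilbert_basis.
exact: algebra_subring.
Qed.

Lemma algebra_sub B s x : subring B -> B x -> algebra B s x.
Proof.
move=> sB Bx; elim: s => //= a s IH.
have sA := algebra_subring s sB.
exact: (adjoin_sub a (submod_self sA)).
Qed.

Lemma algebra_gen B s x : subring B -> x \in s -> algebra B s x.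
Proof.
move=> sB; elim: s => //= a s IH; have sA := algebra_subring s sB.
rewrite inE => /predU1P[->|/IH]; first exact: adjoin_gen.
exact: (adjoin_sub a (submod_self sA)).
Qed.

Lemma algebra_min B s C : subring C -> (forall x, B x -> C x) ->
  {in s, forall x, C x} -> forall x, algebra B s x -> C x.
Proof.
move=> sC BC; elim: s => //= a s IH sC'; apply: adjoin_minr => //.
- by apply: IH => x xs; apply: sC'; rewrite inE xs orbT.
- by apply: sC'; rewrite mem_head.
Qed.

End Subrings.

(** * A subring that contains each unit or its inverse *)

Section FiniteUpTo.
Variable D : comPzRingType.
Implicit Types (B N X : D -> Prop) (s : seq D).

Lemma span_mono (B C : D -> Prop) s x : (forall y, B y -> C y) ->
  span B s x -> span C s x.
Proof.
move=> BC Bx; have [S0 SD SM] := span_submod C s.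
apply: (span_min _ _ Bx); last by move=> y ys; apply: span_mem.
by split=> // b y /BC; apply: SM.
Qed.

Lemma span_subseq B s1 s2 x : {subset s1 <= s2} -> span B s1 x -> span B s2 x.
Proof.
move=> s12; apply: span_min; first exact: span_submod.
by move=> y /s12; apply: span_mem.
Qed.

Lemma lower_terms_min B V N a d : submod B N ->
  (forall i c, (i < d)%N -> V c -> N (a ^+ i * c)) ->
  forall x, lower_terms V a d x -> N x.
Proof.
move=> [N0 ND NM]; elim: d => [|d IH] VN x /= => [->//|[c Vc lx]].
rewrite -(subrK (a ^+ d * c) x); apply: ND; last exact: VN.
by apply: IH lx => i c' lid; apply: VN; apply: ltnW.
Qed.

Lemma adjoin_stable B N a : submod B N -> (forall x, N x -> N (a * x)) ->
  submod (adjoin B a) N.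
Proof.
move=> sN aN; have [N0 ND NM] := sN; split=> // b x + Nx.
apply: (adjoin_min (B := B) (N := fun b => N (b * x))).
- exact: submod_postmul.
- by move=> c Bc; apply: NM.
by move=> c; rewrite -mulrA; apply: aN.
Qed.

Lemma algebra_stable B G N : submod B N ->
  (forall g x, g \in G -> N x -> N (g * x)) -> submod (algebra B G) N.
Proof.
move=> sN; elim: G => //= g G IH GN; apply: adjoin_stable.
  by apply: IH => h x hG; apply: GN; rewrite inE hG orbT.
by move=> x; apply: GN; apply: mem_head.
Qed.

Definition multset (E : D -> Prop) : Prop :=
  E 1 /\ forall x y, E x -> E y -> E (x * y).

Section Saturation.
Variable E : D -> Prop.
Hypothesis mE : multset E.

(** The elements of [D] whose image in the localisation at [E] lies in that of [N]:
    saturated submodules stand for submodules of a localised module. *)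
Definition sat N : D -> Prop := fun x => exists2 e, E e & N (e * x).

Definition finite_upto B : Prop := exists s, forall x, sat (span B s) x.

Lemma sat_sub N x : N x -> sat N x.
Proof. by exists 1; rewrite ?mul1r //; case: mE. Qed.

Lemma sat_sat N x : sat (sat N) x -> sat N x.
Proof.
case=> e Ee [f Ef Nx]; exists (f * e); last by rewrite -mulrA.
by case: mE => _; apply.
Qed.

Lemma sat_mono N N' x : (forall y, N y -> N' y) -> sat N x -> sat N' x.
Proof. by move=> NN' [e Ee /NN' Nx]; exists e. Qed.

Lemma sat_submod B N : (forall x, E x -> B x) -> submod B N -> submod B (sat N).
Proof.
move=> EB [N0 ND NM]; split=> [|x y [e Ee Nx] [f Ef Ny]|b x Bb [e Ee Nx]].
- exact: sat_sub.
- exists (e * f); first by case: mE => _; apply.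
  have -> : e * f * (x + y) = f * (e * x) + e * (f * y) by ring.
  by apply: ND; apply: NM => //; apply: EB.
by exists e => //; rewrite mulrCA; apply: NM.
Qed.

Lemma sat_subring B : (forall x, E x -> B x) -> subring B -> subring (sat B).
Proof.
move=> EB sB; have sS := sat_submod EB (submod_self sB); split.
- by apply: sat_sub; apply: subring1.
- by move=> x y; apply: submodB sB sS.
move=> x y [e Ee Bx] [f Ef By]; exists (e * f); first by case: mE => _; apply.
have -> : e * f * (x * y) = (e * x) * (f * y) by ring.
exact: subringM.
Qed.

Lemma finite_upto_sat B : (forall x, E x -> B x) -> subring B ->
  finite_upto (sat B) -> finite_upto B.
Proof.
move=> EB sB [s fs]; exists s => x; apply: sat_sat; move: (fs x).
apply: sat_mono => {x} x; have [S0 SD SM] := sat_submod EB (span_submod B s).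
apply: span_min; last by move=> y ys; apply: sat_sub; apply: span_mem.
split=> // b y [e Ee Bb] [f Ef Sy]; exists (e * f); first by case: mE => _; apply.
have -> : e * f * (b * y) = (e * b) * (f * y) by ring.
by case: (span_submod B s) => _ _; apply.
Qed.

(** Let [s] generate [D] over both [B[u]] and [B[u']].  As [u y] is a polynomial in
    [u'] of some degree below [d] for each [y] in [s], multiplying it by a high power
    of [u] turns it into a polynomial in [u] of bounded degree.  So the expressions
    of degree at most [d] in [u], with coefficients in the span of [s], are stable
    under [u], hence exhaust [D]. *)
Lemma finite_upto_unit B u u' : (forall x, E x -> B x) -> subring B -> u * u' = 1 ->
  finite_upto (adjoin B u) -> finite_upto (adjoin B u') -> finite_upto B.
Proof.
move=> EB sB uu' [s1 fs1] [s2 fs2]; set s := s1 ++ s2.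
have fs x : sat (span (adjoin B u) s) x.
  apply: sat_mono (fs1 x) => y; apply: span_subseq => z zs.
  by rewrite mem_cat zs.
have fs' x : sat (span (adjoin B u') s) x.
  apply: sat_mono (fs2 x) => y; apply: span_subseq => z zs.
  by rewrite mem_cat zs orbT.
have sV := span_submod B s.
have [d dP] : exists d, {in s, forall y, sat (lower_terms (span B s) u' d) (u * y)}.
  apply: uniform_bound => [i j y lij|y ys].
    by apply: sat_mono => z; apply: (lower_terms_mono sV).
  have [e Ee Sy] := fs' (u * y).
  have [d ld] : adjoin (span B s) u' (e * (u * y)).
    apply: (span_min _ _ Sy); last first.
      by move=> z zs; apply: (adjoin_sub _ sV); apply: span_mem.
    apply: adjoin_stable; first exact: adjoin_submod.
    by move=> z Az; rewrite -(expr1 u'); apply: (adjoin_mulX sV).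
  by exists d, e.
pose L := lower_terms (span B s) u d.+1.
have sL : submod B L by apply: lower_terms_submod.
have sN := sat_submod EB sL.
have uN y : sat L y -> sat L (u * y).
  move=> [e Ee Ly]; apply: sat_sat; exists e => //; rewrite mulrCA.
  move: (e * y) Ly => {e Ee}y.
  apply: (lower_terms_min (B := B) (N := fun y => sat L (u * y))).
    exact: submod_premul.
  move=> i c; rewrite ltnS leq_eqVlt => /predU1P[->|lid] Vc; last first.
    by rewrite mulrA -exprS; apply: sat_sub; apply: (lower_terms_monom _ sV).
  (* multiplying by u may raise the degree to d + 1; rewriting u z over the
     powers of u' lowers it again, because u ^ d cancels them *)
  apply: (span_min (N := fun c => sat L (u * (u ^+ d * c))) _ _ Vc).
    exact: (submod_premul (u ^+ d) (submod_premul u sN)).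
  move=> z zs; have [f Ef lz] := dP z zs.
  exists f => //; have -> : f * (u * (u ^+ d * z)) = u ^+ d * (f * (u * z)) by ring.
  apply: (lower_terms_min (B := B) (N := fun w => L (u ^+ d * w)) _ _ lz).
    exact: submod_premul.
  move=> j c' ljd Vc'; rewrite mulrA -(subnK (ltnW ljd)) exprD -(mulrA _ (u ^+ j)).
  rewrite -exprMn uu' expr1n mulr1; apply: (lower_terms_monom _ sV) => //.
  by rewrite ltnS leq_subLR leq_addl.
pose s' := [seq u ^+ i * y | i <- iota 0 d.+1, y <- s].
exists s' => x.
apply: sat_mono (_ : sat L x); last first.
  apply: sat_sat; apply: sat_mono (fs x) => y; apply: span_min.
    exact: adjoin_stable.
  move=> z zs; apply: sat_sub; rewrite -[z]mul1r -(expr0 u).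
  by apply: (lower_terms_monom _ sV) => //; apply: span_mem.
move=> y.
apply: lower_terms_min; first exact: span_submod.
move=> i c lid; apply: (span_min (N := fun c => span B s' (u ^+ i * c))).
  exact/submod_premul/span_submod.
move=> z zs; apply: span_mem; apply/allpairsP; exists (i, z).
by split=> //; rewrite mem_iota.
Qed.

(** Zorn's lemma applies since [D] is a finitely generated algebra: that [D] is
    spanned by [s] over a subring amounts to finitely many relations, expressing [1]
    and the products of [s] by the algebra generators. *)
Lemma exists_maximal_subring B G : subring B -> (forall x, E x -> B x) ->
  (forall x, algebra B G x) -> ~ finite_upto B ->
  exists O, [/\ subring O, forall x, B x -> O x & ~ finite_upto O] /\
    forall O', subring O' -> (forall x, O x -> O' x) -> ~ finite_upto O' ->
    forall x, O' x -> O x.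
Proof.
move=> sB EB genG nfB.
pose good (O : set D) := [/\ subring O, forall x, B x -> O x & ~ finite_upto O].
have [X [sX _ _]||F Fgood [X0 FX0] Ftot|O [gO maxO]] :=
    exists_maximal_set (good := good).
- by exists 1; apply: subring1.
- by exists B.
- set U := bigcup _ _; have sub X x : F X -> X x -> U x by move=> FX Xx; exists X.
  have [s0 B0 _] := Fgood X0 FX0.
  split=> [|x Bx|[s fs]]; last 1 first.
  + (* finiteness over U involves finitely many coefficients, hence already
       holds over a member of the chain *)
    have spanU x : span U s x -> exists2 X, F X & span X s x.
      apply: (span_min (N := fun x => exists2 X, F X & span X s x)).
        split.
        - by exists X0 => //; case: (span_submod X0 s).
        - move=> v w [X FX Sv] [Y FY Sw]; have [XY|YX] := Ftot X Y FX FY.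
            exists Y => //; case: (span_submod Y s) => _ + _; apply => //.
            exact: span_mono Sv.
          exists X => //; case: (span_submod X s) => _ + _; apply => //.
          exact: span_mono Sw.
        move=> b v [Z FZ Zb] [X FX Sv]; have [XZ|ZX] := Ftot X Z FX FZ.
          exists Z => //; case: (span_submod Z s) => _ _; apply => //.
          exact: span_mono Sv.
        by exists X => //; case: (span_submod X s) => _ _; apply => //; apply: ZX.
      by move=> y ys; exists X0 => //; apply: span_mem.
    have unif (l : seq D) : exists2 X, F X & {in l, forall z, sat (span X s) z}.
      elim: l => [|z l [X FX Xl]]; first by exists X0.
      have [e Ee /spanU[Y FY Sz]] := fs z.
      have [XY|YX] := Ftot X Y FX FY.
        exists Y => // w; rewrite inE => /predU1P[->|/Xl]; first by exists e.
        by apply: sat_mono => v; apply: span_mono.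
      exists X => // w; rewrite inE => /predU1P[->|/Xl//].
      by exists e => //; apply: span_mono Sz.
    have [X FX Xl] := unif (1 :: [seq g * y | g <- G, y <- s]).
    have [sX BX nX] := Fgood X FX; apply: nX; exists s => x.
    have EX y : E y -> X y by move=> /EB/BX.
    have sN : submod X (sat (span X s)).
      by apply: sat_submod => //; apply: span_submod.
    have [|_ _ AM] := @algebra_stable X G _ sN.
      move=> g y gG [e Ee Sy]; apply: sat_sat; exists e => //; rewrite mulrCA.
      apply: (span_min (B := X) (N := fun y => sat (span X s) (g * y)) _ _ Sy).
        exact: submod_premul.
      move=> z zs; apply: Xl; rewrite inE; apply/orP; right.
      by apply/allpairsP; exists (g, z).
    rewrite -[x]mulr1; apply: AM; last by apply: Xl; rewrite mem_head.
    move: (genG x); apply: algebra_min; first exact: algebra_subring.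
      by move=> y /BX; apply: algebra_sub.
    by move=> g gG; apply: algebra_gen.
  + split=> [|x y [X FX Xx] [Y FY Yy]|x y [X FX Xx] [Y FY Yy]].
    * exact: sub FX0 (subring1 s0).
    * have [Z [FZ Zx Zy]] := chain_union2 Ftot FX FY Xx Yy.
      by apply: (sub Z) => //; have [[_ + _] _ _] := Fgood Z FZ; apply.
    * have [Z [FZ Zx Zy]] := chain_union2 Ftot FX FY Xx Yy.
      by apply: (sub Z) => //; have [[_ _ +] _ _] := Fgood Z FZ; apply.
  + exact: sub FX0 (B0 x Bx).
exists O; split=> // O' sO' OO' nO'; apply: maxO => //; split=> // x Bx.
by apply: OO'; case: gO => _ + _; apply.
Qed.

(** The maximal subring [O] behaves like a valuation ring: if neither [u] nor [u']
    were in [O], then [D] would be finite over both [O[u]] and [O[u']], hence over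
    [O]. *)
Lemma exists_valuation_subring B G : subring B -> (forall x, E x -> B x) ->
  (forall x, algebra B G x) -> ~ finite_upto B ->
  exists O, [/\ subring O, forall x, B x -> O x, forall x, sat O x -> O x,
    exists x, ~ O x & forall u u', u * u' = 1 -> O u \/ O u'].
Proof.
move=> sB EB genG nfB.
have [O [[sO BO nO] maxO]] := exists_maximal_subring sB EB genG nfB.
have EO x : E x -> O x by move=> /EB/BO.
have adjO a : ~ O a -> finite_upto (adjoin O a).
  move=> nOa; apply: contrapT => nf; apply: nOa.
  apply: (maxO _ _ _ nf); [exact: adjoin_subring| |exact: adjoin_gen].
  by move=> x; apply: (adjoin_sub _ (submod_self sO)).
exists O; split=> //.
- apply: maxO; [exact: sat_subring|exact: sat_sub|].
  by move/(finite_upto_sat EO sO).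
- apply: contrapT => allO; apply: nO; exists [:: 1] => x; apply: sat_sub.
  rewrite -[x]mulr1; case: (span_submod O [:: 1]) => _ _; apply.
    by apply: contrapT => nx; apply: allO; exists x.
  by apply: span_mem; rewrite mem_head.
move=> u u' uu'; apply: contrapT => /not_orP[nu nu'].
by apply: nO; apply: (finite_upto_unit EO sO uu'); apply: adjO.
Qed.

End Saturation.

End FiniteUpTo.

(** * Chains of saturated submodules have bounded length *)

Section BoundedChains.
Variable D : comPzRingType.
Implicit Types (B N X : D -> Prop) (s : seq D).

Lemma noeth_maximal B (C : (D -> Prop) -> Prop) : subring B -> noeth_subring B ->
  (forall N, C N -> submod B N /\ forall x, N x -> B x) -> (exists N, C N) ->
  exists2 N, C N & forall N', C N' -> (forall x, N x -> N' x) ->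
    forall x, N' x -> N x.
Proof.
move=> sB nB CB [N0 CN0]; apply: contrapT => nmax.
pose T := {N : D -> Prop | C N}.
have next (N : T) : exists N' : T, (forall x, sval N x -> sval N' x) /\
    exists2 x, sval N' x & ~ sval N x.
  case: N => N CN /=; apply: contrapT => nN; apply: nmax.
  exists N => // N' CN' NN' x N'x.
  by apply: contrapT => nNx; apply: nN; exists (exist _ N' CN'); split=> //=; exists x.
have [f fP] := choice next.
pose s i := iter i f (exist C N0 CN0).
have [m sm] := noeth_chain sB nB (fun i => (CB _ (svalP (s i))).1)
  (fun i => (CB _ (svalP (s i))).2) (fun i => (fP (s i)).1).
by have [_ [x sx]] := fP (s m); apply; apply: (sm m.+1).
Qed.

(** The complement of [E] in [B] is a prime ideal minimal over [t]; the last clause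
    is the form in which minimality is used, namely that each element of the prime
    is nilpotent modulo [t] in the localised ring. *)
Lemma exists_maximal_multset B t : subring B -> B t ->
  (forall b, B b -> 1 <> t * b) ->
  exists E, [/\ multset E, forall x, E x -> B x,
    forall e b, E e -> B b -> e <> t * b &
    forall q, B q -> ~ E q -> exists e i b, [/\ E e, B b & e * q ^+ i = t * b]].
Proof.
move=> sB Bt nt1.
pose good (E : set D) := [/\ multset E, forall x, E x -> B x &
  forall e b, E e -> B b -> e <> t * b].
have [X [[X1 _] _ _]||F Fgood [X0 FX0] Ftot|E [[[E1 EM] EB Et] maxE]] :=
    exists_maximal_set (good := good).
- by exists 1.
- exists (fun x => x = 1); split=> [|x ->|e b ->]; [|exact: subring1|exact: nt1].
  by split=> // x y -> ->; rewrite mulr1.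
- split.
  + split=> [|x y [X FX Xx] [Y FY Yy]].
      by exists X0 => //; have [[]] := Fgood X0 FX0.
    have [Z [FZ Zx Zy]] := chain_union2 Ftot FX FY Xx Yy.
    by exists Z => //; have [[_ +] _ _] := Fgood Z FZ; apply.
  + by move=> x [X FX Xx]; have [_ + _] := Fgood X FX; apply.
  + by move=> e b [X FX Xe]; have [_ _] := Fgood X FX; apply.
exists E; split=> // q Bq nEq; apply: contrapT => nq; apply: nEq.
pose E' x := exists e i, E e /\ x = e * q ^+ i.
apply: (maxE E'); last by exists 1, 1%N; rewrite mul1r expr1.
  split.
  - split; first by exists 1, 0%N; rewrite mulr1.
    move=> _ _ [e [i [Ee ->]]] [f [j [Ef ->]]]; exists (e * f), (i + j)%N.
    by split; [exact: EM|rewrite exprD; ring].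
  - move=> _ [e [i [Ee ->]]]; apply: subringM => //; first exact: EB.
    exact: subringX.
  - by move=> _ b [e [i [Ee ->]]] Bb eq; apply: nq; exists e, i, b.
by move=> x Ex; exists x, 0%N; rewrite mulr1.
Qed.

Section Chains.
Variables (B E : D -> Prop) (t t' : D).
Hypotheses (sB : subring B) (mE : multset E) (EB : forall x, E x -> B x).
Hypothesis tt' : t * t' = 1.

Definition add_gen X y : D -> Prop := fun x => exists2 c, B c & X (x - c * y).
Definition add_gens X s : D -> Prop := foldl add_gen X s.

(** Each term of [s] increases the saturation of the submodule generated by [X] and
    the terms before it: such a list is a strict chain of saturated submodules. *)
Fixpoint indep X s : Prop :=
  if s is z :: s' then ~ sat E X z /\ indep (add_gen X z) s' else True.

(** The list [s] gives the steps of a composition series above [X] in the localised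
    modules: each step is killed by the complement of [E], so that its localisation
    is zero or simple. *)
Fixpoint composition X s : Prop :=
  if s is y :: s' then
    (forall q, B q -> ~ E q -> sat E X (q * y)) /\ composition (add_gen X y) s'
  else True.

Lemma add_gen_submod X y : submod B X -> submod B (add_gen X y).
Proof.
move=> [X0 XD XM]; split=> [|u v [c Bc Xu] [d Bd Xv]|b u Bb [c Bc Xu]].
- by exists 0; [exact: subring0|rewrite mul0r subr0].
- exists (c + d); first exact: subringD.
  have -> : u + v - (c + d) * y = (u - c * y) + (v - d * y) by ring.
  exact: XD.
exists (b * c); first exact: subringM.
have -> : b * u - b * c * y = b * (u - c * y) by ring.
exact: XM.
Qed.

Lemma add_gen_sub X y x : X x -> add_gen X y x.
Proof. by exists 0; [exact: subring0|rewrite mul0r subr0]. Qed.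

Lemma add_gen_mem X y : submod B X -> add_gen X y y.
Proof. by case=> X0 _ _; exists 1; [exact: subring1|rewrite mul1r subrr]. Qed.

Lemma add_gen_min X N y : submod B N -> (forall x, X x -> N x) -> N y ->
  forall x, add_gen X y x -> N x.
Proof.
move=> [_ ND NM] XN Ny x [c Bc Xx]; rewrite -(subrK (c * y) x).
by apply: ND; [exact: XN|exact: NM].
Qed.

Lemma add_gen_mono X1 X2 y : submod B X2 -> (forall x, X1 x -> sat E X2 x) ->
  forall x, add_gen X1 y x -> sat E (add_gen X2 y) x.
Proof.
move=> sX2 X12; apply: add_gen_min.
- by apply: sat_submod => //; apply: add_gen_submod.
- by move=> x /X12; apply: sat_mono => z; apply: add_gen_sub.
- by apply: sat_sub => //; apply: add_gen_mem.
Qed.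

Lemma add_gens_submod X s : submod B X -> submod B (add_gens X s).
Proof. by elim: s X => //= y s IH X sX; apply/IH/add_gen_submod. Qed.

Lemma add_gens_sub X s x : X x -> add_gens X s x.
Proof. by elim: s X => //= y s IH X Xx; apply/IH/add_gen_sub. Qed.

Lemma add_gens_min X N s : submod B N -> (forall x, X x -> N x) ->
  {in s, forall y, N y} -> forall x, add_gens X s x -> N x.
Proof.
move=> sN; elim: s X => //= y s IH X XN Ns; apply: IH.
  by apply: add_gen_min => //; apply: Ns; apply: mem_head.
by move=> z zs; apply: Ns; rewrite inE zs orbT.
Qed.

Lemma add_gens_mono X1 X2 s : submod B X2 -> (forall x, X1 x -> sat E X2 x) ->
  forall x, add_gens X1 s x -> sat E (add_gens X2 s) x.
Proof.
elim: s X1 X2 => //= y s IH X1 X2 sX2 X12; apply: IH; first exact: add_gen_submod.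
exact: add_gen_mono.
Qed.

Lemma sat_trans X1 X2 x : (forall y, X1 y -> sat E X2 y) -> sat E X1 x -> sat E X2 x.
Proof. by move=> X12 /(sat_mono X12); apply: sat_sat. Qed.

Lemma indep_mono X1 X2 s : submod B X2 -> (forall x, X1 x -> sat E X2 x) ->
  indep X2 s -> indep X1 s.
Proof.
elim: s X1 X2 => //= z s IH X1 X2 sX2 X12 [nz iz]; split.
  by move/(sat_trans X12).
by apply: IH iz; [exact: add_gen_submod|exact: add_gen_mono].
Qed.

Lemma composition_mono X1 X2 s : submod B X2 -> (forall x, X1 x -> sat E X2 x) ->
  composition X1 s -> composition X2 s.
Proof.
elim: s X1 X2 => //= y s IH X1 X2 sX2 X12 [cy cs]; split.
  by move=> q Bq /(cy q Bq)/(sat_trans X12).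
by apply: IH cs; [exact: add_gen_submod|exact: add_gen_mono].
Qed.

Lemma indep_cat X s1 s2 :
  indep X (s1 ++ s2) <-> indep X s1 /\ indep (add_gens X s1) s2.
Proof. by elim: s1 X => [|z s1 IH] X /=; rewrite ?IH; tauto. Qed.

Lemma composition_cat X s1 s2 : composition X (s1 ++ s2) <->
  composition X s1 /\ composition (add_gens X s1) s2.
Proof. by elim: s1 X => [|z s1 IH] X /=; rewrite ?IH; tauto. Qed.

(** The dropped element is the first [z] that brings [y] into the saturation.  Before
    [z], a relation involving [c y] either has [c] in [E], and so reaches [y] too
    early, or has [c] outside [E], where [c y] is already accounted for by [X]. *)
Lemma exchange X y s : submod B X -> (forall q, B q -> ~ E q -> sat E X (q * y)) ->
  indep X s -> exists s', [/\ {subset s' <= s}, (size s <= (size s').+1)%N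
    & indep (add_gen X y) s'].
Proof.
elim: s X => [|z s IH] X sX cy /= => [_|[nz iz]]; first by exists [::].
have sXz := add_gen_submod z sX.
have [Xzy|nXzy] := pselect (sat E (add_gen X z) y).
  exists s; split=> [w ws|//|]; first by rewrite inE ws orbT.
  apply: indep_mono iz => //; apply: add_gen_min => //; first exact: sat_submod.
  by move=> x Xx; apply: sat_sub => //; apply: add_gen_sub.
have [|s' [ss' sz is']] := IH _ sXz _ iz.
  by move=> q Bq /(cy q Bq); apply: sat_mono => w; apply: add_gen_sub.
exists (z :: s'); split=> //= [w|].
  by rewrite !inE => /predU1P[->|/ss' ->]; rewrite ?eqxx ?orbT.
have adjC X0 u v : forall x, add_gen (add_gen X0 u) v x -> add_gen (add_gen X0 v) u x.
  move=> x [c Bc [d Bd Xx]]; exists d => //; exists c => //.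
  by rewrite (_ : x - d * u - c * v = x - c * v - d * u) //; ring.
split; last first.
  apply: indep_mono is'; first exact: add_gen_submod.
  by move=> x /adjC; apply: sat_sub.
case=> e Ee [c Bc Xz]; have [Ec|nEc] := pselect (E c).
  apply: nXzy; exists c => //; exists e; first exact: EB.
  rewrite (_ : c * y - e * z = - (e * z - c * y)); last by ring.
  by apply: (submodN sB sX).
apply: nz; apply: (sat_sat mE); exists e => //.
rewrite -(subrK (c * y) (e * z)).
have [_ SD _] := sat_submod mE EB sX.
by apply: SD; [exact: sat_sub|exact: cy].
Qed.

(** A Jordan-Holder bound, proved like the Steinitz exchange lemma: passing from [X] to
    the first step of the composition series costs one term of [s]. *)
Lemma indep_size X ys s : submod B X -> composition X ys -> indep X s ->
  {in s, forall z, sat E (add_gens X ys) z} -> (size s <= size ys)%N.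
Proof.
elim: ys X s => [|y ys IH] X s sX /= => [_|[cy cys]] is_ sE.
  case: s is_ sE => //= z s [nz _] /(_ z (mem_head _ _)).
  by move/nz.
have [s' [ss' le_s is']] := exchange sX cy is_.
apply: leq_trans le_s _; apply: (IH _ s' (add_gen_submod y sX) cys is').
by move=> z /ss'/sE.
Qed.

(** The submodule [u X], for [u'] the inverse of [u]. *)
Definition scaled u' X : D -> Prop := fun x => X (u' * x).

Lemma scaled_submod u' X : submod B X -> submod B (scaled u' X).
Proof. exact: submod_premul. Qed.

Section Scale.
Variables u u' : D.
Hypothesis uu' : u * u' = 1.

Lemma scaled_mul X x : scaled u' X (u * x) <-> X x.
Proof. by rewrite /scaled mulrA (mulrC u') uu' mul1r. Qed.

Lemma add_gen_scaled X y x :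
  add_gen (scaled u' X) (u * y) x <-> scaled u' (add_gen X y) x.
Proof.
rewrite /add_gen /scaled.
have eqn c : u' * (x - c * (u * y)) = u' * x - c * y.
  have -> : u' * (x - c * (u * y)) = u' * x - c * (u * u') * y by ring.
  by rewrite uu' mulr1.
by split=> -[c Bc Xx]; exists c => //; move: Xx; rewrite eqn.
Qed.

Lemma sat_scaled X x : sat E (scaled u' X) (u * x) <-> sat E X x.
Proof.
by split=> -[e Ee Xe]; exists e => //; move: Xe; rewrite mulrCA scaled_mul.
Qed.

Lemma indep_scaled X s : submod B X ->
  indep X s -> indep (scaled u' X) (map ( *%R u) s).
Proof.
elim: s X => //= z s IH X sX [nz iz]; split; first by rewrite sat_scaled.
apply: indep_mono (IH _ (add_gen_submod z sX) iz).
  exact/scaled_submod/add_gen_submod.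
by move=> x Xx; apply: sat_sub => //; apply/add_gen_scaled.
Qed.

Lemma composition_scaled X s : submod B X ->
  composition X s -> composition (scaled u' X) (map ( *%R u) s).
Proof.
elim: s X => //= y s IH X sX [cy cs]; split.
  by move=> q Bq /(cy q Bq); rewrite mulrCA sat_scaled.
apply: composition_mono (IH _ (add_gen_submod y sX) cs).
  exact/add_gen_submod/scaled_submod.
by move=> x Xx; apply: sat_sub => //; apply/add_gen_scaled.
Qed.

Lemma add_gens_scaled X s x : submod B X -> add_gens X s x ->
  sat E (add_gens (scaled u' X) (map ( *%R u) s)) (u * x).
Proof.
elim: s X => [|y s IH] X sX /=; first by move=> Xx; apply/(sat_sub mE)/scaled_mul.
move/(IH _ (add_gen_submod y sX)); apply: sat_trans; apply: add_gens_mono.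
  exact/add_gen_submod/scaled_submod.
by move=> z Xz; apply: sat_sub => //; apply/add_gen_scaled.
Qed.
End Scale.

Hypothesis nB : noeth_subring B.
Hypothesis Bt : B t.
Hypothesis Emax : forall q, B q -> ~ E q ->
  exists e i b, [/\ E e, B b & e * q ^+ i = t * b].

Let sBB := submod_self sB.
Let stB := scaled_submod t' sBB.

(** Take the largest ideal reached from [t B] by a composition series.  If its
    saturation omitted [1], choose [y] outside this saturation with a maximal
    annihilator modulo it.  Maximality makes [q y] vanish for each [q] outside [E], as
    some [e q^i] with [e] in [E] lies in [t B]; so [y] prolongs the series. *)
Lemma exists_composition_series :
  exists ys, composition (scaled t' B) ys /\ sat E (add_gens (scaled t' B) ys) 1.
Proof.
pose X0 := scaled t' B.
have X0B x : X0 x -> B x.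
  by move=> X0x; rewrite -[x]mul1r -tt' -mulrA; apply: subringM.
pose C X := exists ys,
  [/\ {in ys, forall y, B y}, composition X0 ys & X = add_gens X0 ys].
have CB X : C X -> submod B X /\ forall x, X x -> B x.
  case=> ys [ysB _ ->]; split; first exact: add_gens_submod.
  by apply: add_gens_min.
have [|X [ys [ysB cys eX]] maxX] := noeth_maximal sB nB CB.
  by exists X0, [::].
have [sX XB] := CB X (ex_intro _ ys (And3 ysB cys eX)).
exists ys; split=> //; rewrite -/X0 -eX; apply: contrapT => nX1.
pose ann y c := B c /\ sat E X (c * y).
have [S0 SD SM] := sat_submod mE EB sX.
have [| |_ [y [[By nXy] ->]] maxy] := @noeth_maximal B
    (fun I => exists y, (B y /\ ~ sat E X y) /\ I = ann y) sB nB.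
- move=> _ [y [[By _] ->]]; split; last by move=> x [].
  split; first by split; [exact: subring0|rewrite mul0r].
    move=> c d [Bc Xc] [Bd Xd]; split; first exact: subringD.
    by rewrite mulrDl; apply: SD.
  move=> b c Bb [Bc Xc]; split; first exact: subringM.
  by rewrite -mulrA; apply: SM.
- by exists (ann 1), 1; split=> //; split=> //; apply: subring1.
have cy q : B q -> ~ E q -> sat E X (q * y).
  move=> Bq nEq; apply: contrapT => nXqy.
  have nXi i : ~ sat E X (q ^+ i * y).
    elim: i => [|i IH]; first by rewrite mul1r.
    rewrite exprS -mulrA => Xi; apply: nXqy.
    suff [] : ann y q by [].
    apply: (maxy (ann (q ^+ i * y))).
    - exists (q ^+ i * y); split=> //; split=> //.
      by apply: subringM => //; apply: subringX.
    - by move=> c [Bc Xc]; split=> //; rewrite mulrCA; apply: SM => //; apply: subringX.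
    - by split.
  have [e [i [b [Ee Bb eqi]]]] := Emax Bq nEq.
  apply: (nXi i); exists e => //; rewrite mulrA eqi eX; apply: add_gens_sub.
  by rewrite -mulrA /X0 scaled_mul //; apply: subringM.
apply: nXy; apply: sat_sub => //; apply: (maxX (add_gen X y)).
- exists (rcons ys y); split.
  + by move=> z; rewrite mem_rcons inE => /predU1P[->|/ysB].
  + by rewrite -cats1 composition_cat /= -eX.
  + by rewrite /add_gens foldl_rcons -/(add_gens X0 ys) -eX.
- by move=> x; apply: add_gen_sub.
- exact: add_gen_mem.
Qed.

(** The deepest layer [t^(k-1) s] comes first, as independence adds terms from the
    smallest submodule up. *)
Definition layers s k := iter k (fun w => map ( *%R t) w ++ s) [::].

Lemma size_layers s k : size (layers s k) = (k * size s)%N.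
Proof. by elim: k => //= k IH; rewrite size_cat size_map IH mulSn addnC. Qed.

Lemma layersP (P : D -> Prop) s k :
  (forall x, P x -> P (t * x)) -> {in s, forall x, P x} ->
  {in layers s k, forall x, P x}.
Proof.
move=> Pt Ps; elim: k => //= k IH x; rewrite mem_cat => /orP[/mapP[y /IH Py ->]|/Ps //].
exact: Pt.
Qed.

Lemma composition_layers ys k :
  composition (scaled t' B) ys -> sat E (add_gens (scaled t' B) ys) 1 ->
  composition (scaled (t' ^+ k) B) (layers ys k) /\
  forall x, B x -> sat E (add_gens (scaled (t' ^+ k) B) (layers ys k)) x.
Proof.
move=> cys ys1; elim: k => [|k [IHc IHs]].
  by split=> // x Bx; apply: sat_sub; rewrite // /add_gens /= /scaled mul1r.
have sk := scaled_submod (t' ^+ k) sBB; have sk1 := scaled_submod (t' ^+ k.+1) sBB.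
have sub x : scaled t' (scaled (t' ^+ k) B) x -> sat E (scaled (t' ^+ k.+1) B) x.
  by move=> Bx; apply: sat_sub => //; move: Bx; rewrite /scaled mulrA -exprSr.
have sL := add_gens_submod (map ( *%R t) (layers ys k)) sk1.
have tL x : scaled t' B x ->
    sat E (add_gens (scaled (t' ^+ k.+1) B) (map ( *%R t) (layers ys k))) x.
  move=> tBx; rewrite -[x]mul1r -tt' -mulrA.
  have [e Ee Le] := IHs _ tBx.
  apply: (sat_sat mE); exists e => //; rewrite mulrCA.
  apply: sat_trans (add_gens_scaled tt' sk Le); apply: add_gens_mono => //.
have cys' := composition_mono sL tL cys.
split.
  rewrite composition_cat; split=> //.
  exact: composition_mono (composition_scaled tt' sk IHc).
move=> x Bx; rewrite /add_gens foldl_cat -/(add_gens _ _) -/(add_gens _ _).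
have [_ _ SM] := sat_submod mE EB (add_gens_submod ys sL).
rewrite -[x]mulr1; apply: SM => //.
by apply: sat_trans ys1; apply: add_gens_mono.
Qed.

(** The argument of Krull and Akizuki.  If [s] has [k] terms, the [b] layers
    [s], [t s], ..., [t^(b-1) s] form [b k] independent terms above [t^b O].  After
    multiplication by a power [t^a] that brings [s] into [B] they are compared with
    the [a + b] layers of a composition series of [B/t] of length [e]: so
    [b k <= (a + b) e], and a large [b] gives [k <= e]. *)
Lemma chain_bound O : subring O -> (forall x, B x -> O x) ->
  (forall x, exists a, B (t ^+ a * x)) ->
  exists e, forall s, {in s, forall z, O z} -> indep (scaled t' O) s -> (size s <= e)%N.
Proof.
move=> sO BO gen.
have sBO : submod B O.
  by have [O0 OD OM] := submod_self sO; split=> // b x /BO; apply: OM.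
have [ys [cys ys1]] := exists_composition_series.
exists (size ys) => s sO' is_.
have [a aP] : exists a, {in s, forall z, B (t ^+ a * z)}.
  apply: uniform_bound => [i j x /subnK <-|x _]; last exact: gen.
  by rewrite exprD -mulrA => Bx; apply: subringM => //; apply: subringX.
have stO := scaled_submod t' sBO.
have iL k : indep (scaled (t' ^+ k) O) (layers s k).
  elim: k => //= k IH; have sk := scaled_submod (t' ^+ k) sBO.
  have sk1 := scaled_submod (t' ^+ k.+1) sBO.
  rewrite indep_cat; split.
    apply: indep_mono (indep_scaled tt' sk IH); first exact: scaled_submod.
    by move=> x; rewrite /scaled exprSr -mulrA; apply: sat_sub.
  apply: indep_mono is_ => // x; move=> Lx; apply: sat_sub => //; move: x Lx.
  apply: add_gens_min => // [x|_ /mapP[y yL ->]].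
    rewrite /scaled exprS => Ox.
    have -> : t' * x = t ^+ k * (t' * t' ^+ k * x).
      have : t ^+ k * t' ^+ k = 1 by rewrite -exprMn tt' expr1n.
      by move=> e1; rewrite -[t' * x]mul1r -e1; ring.
    by apply: subringM => //; apply: subringX => //; apply: BO.
  rewrite scaled_mul //; move: y yL; apply: layersP => // x Ox.
  by apply: subringM => //; apply: BO.
(* the least b for which b k <= (a + b) e forces k <= e *)
pose b := (a * size ys).+1.
have tta : t ^+ a * t' ^+ a = 1 by rewrite -exprMn tt' expr1n.
have sb := scaled_submod (t' ^+ b) sBO.
have := indep_scaled tta sb (iL b).
have [cL LB] := composition_layers (a + b) cys ys1.
have sab := scaled_submod (t' ^+ (a + b)) sBB.
move/(@indep_mono (scaled (t' ^+ (a + b)) B)) => /(_ (scaled_submod _ sb)) iL'.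
have /iL' {}iL' x : scaled (t' ^+ (a + b)) B x ->
    sat E (scaled (t' ^+ a) (scaled (t' ^+ b) O)) x.
  by move=> Bx; apply: sat_sub => //; rewrite /scaled mulrA -exprD addnC; apply: BO.
have LB' : {in map ( *%R (t ^+ a)) (layers s b),
    forall z, sat E (add_gens (scaled (t' ^+ (a + b)) B) (layers ys (a + b))) z}.
  move=> _ /mapP[y yL ->]; apply: LB; move: y yL; apply: layersP => // x Bx.
  by rewrite mulrCA; apply: subringM.
have := indep_size sab cL iL' LB'; rewrite size_map !size_layers.
rewrite /b; set k := size s; set e := size ys => le_.
rewrite leqNgt; apply/negP => lt_ek.
have : ((a * e).+1 * e.+1 <= (a + (a * e).+1) * e)%N.
  by apply: leq_trans le_; rewrite leq_mul2l lt_ek orbT.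
by rewrite mulnS mulnDl leq_add2r ltnn.
Qed.

End Chains.

End BoundedChains.

(** * A discrete valuation on the units *)

Section Valuation.
Variable D : comPzRingType.
Implicit Types (B N X : D -> Prop) (s : seq D).

Section ValueGroup.
Variables (B E O : D -> Prop) (t t' : D) (e : nat).
Hypotheses (sB : subring B) (mE : multset E) (EB : forall x, E x -> B x).
Hypotheses (sO : subring O) (BO : forall x, B x -> O x).
Hypothesis satO : forall x, sat E O x -> O x.
Hypothesis totalO : forall u u', u * u' = 1 -> O u \/ O u'.
Hypotheses (tt' : t * t' = 1) (Ot : O t) (nOt' : ~ O t').
Hypothesis genO : forall x, exists a, O (t ^+ a * x).
Hypothesis boundO : forall s, {in s, forall z, O z} -> indep B E (scaled t' O) s ->
  (size s <= e)%N.

Let sBO : submod B O.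
Proof. by have [O0 OD OM] := submod_self sO; split=> // b x /BO; apply: OM. Qed.

Definition divides x y : Prop := exists2 c, O c & y = x * c.

Lemma divides_refl x : divides x x.
Proof. by exists 1; [exact: subring1|rewrite mulr1]. Qed.

Lemma divides_trans y x z : divides x y -> divides y z -> divides x z.
Proof.
by move=> [c Oc ->] [d Od ->]; exists (c * d); [exact: subringM|rewrite mulrA].
Qed.

Lemma divides_mul x y z w : divides x y -> divides z w -> divides (x * z) (y * w).
Proof.
move=> [c Oc ->] [d Od ->]; exists (c * d); first exact: subringM.
by rewrite mulrACA.
Qed.

Lemma divides_exp x y k : divides x y -> divides (x ^+ k) (y ^+ k).
Proof.
move=> xy; elim: k => [|k IH]; first exact: divides_refl.
by rewrite !exprS; apply: divides_mul.
Qed.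

Lemma divides_cancel u x y : is_unit u -> divides (u * x) (u * y) -> divides x y.
Proof.
move=> [u' uu'] [c Oc eq]; exists c => //.
by rewrite -[y]mul1r -uu' (mulrC u) -mulrA eq !mulrA (mulrC u') uu' mul1r.
Qed.

Lemma divides_total u v : is_unit u -> is_unit v -> divides u v \/ divides v u.
Proof.
move=> [u' uu'] [v' vv'].
have [|Oc|Oc] := @totalO (u' * v) (u * v').
- have -> : u' * v * (u * v') = (u * u') * (v * v') by ring.
  by rewrite uu' vv' mulr1.
- by left; exists (u' * v) => //; rewrite mulrA uu' mul1r.
- by right; exists (u * v') => //; rewrite mulrCA vv' mulr1.
Qed.

Lemma is_unitM (u v : D) : is_unit u -> is_unit v -> is_unit (u * v).
Proof.
move=> [u' uu'] [v' vv']; exists (u' * v').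
by rewrite mulrACA uu' vv' mulr1.
Qed.

Lemma is_unitX (u : D) k : is_unit u -> is_unit (u ^+ k).
Proof. by move=> [u' uu']; exists (u' ^+ k); rewrite -exprMn uu' expr1n. Qed.

Lemma is_unit1 : is_unit (1 : D). Proof. by exists 1; rewrite mulr1. Qed.

(** Strictly increasing ideals of [O] generated by units of [D], from [w O] up. *)
Fixpoint chain w s : Prop :=
  if s is v :: s' then
    [/\ O v, is_unit v, divides v w & ~ divides w v] /\ chain v s'
  else True.

Lemma chain_in w s : chain w s -> {in s, forall v, O v}.
Proof.
elim: s w => //= v s IH w [[Ov _ _ _] /IH cs] z.
by rewrite inE => /predU1P[->|/cs].
Qed.

(** The ideals generated by units of [D] are saturated, because [O] is. *)
Lemma chain_indep w w' s : w * w' = 1 -> chain w s -> indep B E (scaled w' O) s.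
Proof.
elim: s w w' => //= v s IH w w' ww' [[Ov [v' vv'] vw nwv] /(IH _ _ vv') is_].
split.
  case=> f Ef Ofv; apply: nwv; exists (w' * v); last by rewrite mulrA ww' mul1r.
  by apply: satO; exists f => //; rewrite mulrCA.
apply: indep_mono is_ => //; first exact: scaled_submod.
move=> x Ax; apply: sat_sub => //; move: x Ax; apply: (add_gen_min (B := B)).
- exact: scaled_submod.
- move=> x Ox; have [c Oc wv] := vw; rewrite /scaled.
  have -> : v' * x = c * (w' * x).
    by rewrite -[x in LHS]mul1r -ww' wv -[c in RHS]mul1r -vv'; ring.
  exact: subringM.
- by rewrite /scaled mulrC vv'; apply: subring1.
Qed.

Lemma chain_rcons w s v : chain w (rcons s v) <->
  chain w s /\ [/\ O v, is_unit v, divides v (last w s) & ~ divides (last w s) v].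
Proof. by elim: s w => [|u s IH] w /=; rewrite ?IH; tauto. Qed.

(** In a longest chain of principal ideals from [t O] up to [O], the last proper ideal
    is maximal among the proper ideals generated by units. *)
Lemma exists_uniformizer : exists p, [/\ O p, is_unit p, ~ divides p 1 &
  forall v, O v -> is_unit v -> ~ divides v 1 -> divides p v].
Proof.
have ut : is_unit t by exists t'.
have nt1 : ~ divides t 1.
  move=> [c Oc eq]; apply: nOt'; suff -> : t' = c by [].
  by rewrite -[t']mulr1 eq mulrA (mulrC t') tt' mul1r.
pose P k := `[< exists s, size s = k /\ chain t (rcons s 1) >].
have exP : exists k, P k.
  exists 0%N; apply/asboolP; exists [::]; split=> //=; split=> //; split=> //.
  - exact: subring1.
  - exact: is_unit1.
  - by exists t; rewrite ?mul1r.
have boundP k : P k -> (k <= e)%N.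
  move=> /asboolP[s [<- cs]]; apply: ltnW; rewrite -(size_rcons s 1).
  by apply: boundO; [exact: chain_in cs|exact: chain_indep cs].
case: (ex_maxnP exP boundP) => k /asboolP[s [sk]] cs1 maxk.
have /chain_rcons[cs [O1 u1 _ np1]] := cs1.
set p := last t s in np1.
have [Op up] : O p /\ is_unit p.
  rewrite /p; case/lastP: {p sk cs1 np1} s cs => [//|s v] /chain_rcons[_ [Ov uv _ _]].
  by rewrite last_rcons.
exists p; split=> // v Ov uv nv1; apply: contrapT => npv.
have [//|vp] := divides_total up uv.
suff : P k.+1 by move=> /maxk; rewrite ltnn.
apply/asboolP; exists (rcons s v); split; first by rewrite size_rcons sk.
apply/chain_rcons; split; first by apply/chain_rcons; split.
by rewrite last_rcons; split=> //; exists v; rewrite ?mul1r.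
Qed.

(** The powers of a uniformizer [p] form chains above [t O] until they enter it, so
    some power of [p] lies in [t O].  Hence every unit of [D] is, up to a unit of [O],
    a quotient of two powers of [p], and the difference of the exponents is its
    value. *)
Lemma exists_valuation : exists v : D -> int,
  [/\ forall x y, is_unit x -> is_unit y -> v (x * y) = v x + v y,
      forall x y, x * y = 1 -> O x -> O y -> v x = 0 & v t <> 0].
Proof.
have [p [Op up np1 pmin]] := exists_uniformizer.
have upX k : is_unit (p ^+ k) by apply: is_unitX.
have powS k : ~ divides (p ^+ k.+1) (p ^+ k).
  rewrite exprSr -{2}[p ^+ k]mulr1 => /divides_cancel h.
  exact/np1/h.
have pow_le i j : divides (p ^+ i) (p ^+ j) -> (i <= j)%N.
  move=> dij; rewrite leqNgt; apply/negP => lji; apply: (powS j).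
  apply: divides_trans dij; rewrite -(subnKC lji) exprD.
  by exists (p ^+ (i - j.+1)) => //; apply: subringX.
have [k0 tp] : exists k, divides t (p ^+ k).
  exists e.+1; have [//|pt] := @divides_total t (p ^+ e.+1) (ex_intro _ t' tt') (upX _).
  pose powers k := iteri k (fun i => cons (p ^+ i)) [::].
  have cp k : chain (p ^+ k) (powers k).
    elim: k => //= k IH; split=> //; split=> //; first exact: subringX.
    by exists p; rewrite // exprSr.
  have sp k : size (powers k) = k by elim: k => //= k ->.
  have [p' pp'] := upX e.+1.
  suff /boundO : indep B E (scaled t' O) (powers e.+1).
    by rewrite sp ltnn => h; have := h (chain_in (cp _)).
  apply: indep_mono (chain_indep pp' (cp e.+1)) => //; first exact: scaled_submod.
  move=> x Ox; apply: sat_sub => //; rewrite /scaled; have [c Oc tc] := pt.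
  have -> : p' * x = c * (t' * x).
    by rewrite -[x in LHS]mul1r -tt' tc -[c in RHS]mul1r -pp'; ring.
  exact: subringM.
pose assoc x y := divides x y /\ divides y x.
pose val u z := exists a b : nat, z = a%:Z - b%:Z /\ assoc (p ^+ b * u) (p ^+ a).
have integral u : exists m, O (p ^+ m * u).
  have [a Oa] := genO u; exists (k0 * a)%N.
  have [c Oc ptc] := divides_exp a tp; rewrite exprM ptc mulrAC.
  exact: subringM.
have assoc_pow m v : O v -> is_unit v -> divides v (p ^+ m) ->
    exists j, assoc v (p ^+ j).
  elim: m v => [|m IH] v Ov uv vm.
    by exists 0%N; split=> //; exists v; rewrite ?mul1r.
  have [v1|nv1] := pselect (divides v 1).
    by exists 0%N; split=> //; exists v; rewrite ?mul1r.
  have [w Ow vw] := pmin v Ov uv nv1.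
  have uw : is_unit w.
    by have [v' vv'] := uv; exists (p * v'); rewrite mulrA (mulrC w) -vw.
  have [|j [wj jw]] := IH w Ow uw.
    by apply: (divides_cancel up); rewrite -vw -exprS.
  exists j.+1; rewrite vw exprS.
  by split; apply: divides_mul => //; apply: divides_refl.
have ex_val u : is_unit u -> exists z, val u z.
  move=> uu; have [m Om] := integral u; have um := is_unitM (upX m) uu.
  have [m' mm'] := um; have [k Ok] := integral m'.
  have [|j aj] := assoc_pow k _ Om um.
    by exists (p ^+ k * m') => //; rewrite mulrCA mm' mulr1.
  by exists (j%:Z - m%:Z), j, m.
have assoc_mul x y z w : assoc x y -> assoc z w -> assoc (x * z) (y * w).
  by move=> [xy yx] [zw wz]; split; apply: divides_mul.
have assoc_refl x : assoc x x by split; apply: divides_refl.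
have val_uniq u z w : val u z -> val u w -> z = w.
  move=> [a [b [-> ab]]] [c [d [-> cd]]].
  have [h1 h2] := assoc_mul _ _ _ _ (assoc_refl (p ^+ d)) ab.
  have [h3 h4] := assoc_mul _ _ _ _ (assoc_refl (p ^+ b)) cd.
  have eqm : p ^+ d * (p ^+ b * u) = p ^+ b * (p ^+ d * u) by rewrite mulrCA.
  have eq : (d + a = b + c)%N.
    apply/eqP; rewrite eqn_leq; apply/andP; split; apply: pow_le; rewrite !exprD.
      by apply: divides_trans h2 _; rewrite eqm.
    by apply: divides_trans h4 _; rewrite -eqm.
  have : d%:Z + a%:Z = b%:Z + c%:Z by rewrite -!PoszD eq.
  lia.
have val_mul u z u2 w : val u z -> val u2 w -> val (u * u2) (z + w).
  move=> [a [b [-> ab]]] [c [d [-> cd]]]; exists (a + c)%N, (b + d)%N.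
  split; first lia.
  by rewrite !exprD mulrACA; apply: assoc_mul.
have /choice[v vP] : forall u, exists z, is_unit u -> val u z.
  move=> u.
  have [/ex_val[z uz]|nu] := pselect (is_unit u); first by exists z.
  by exists 0.
have val0 x y : x * y = 1 -> O x -> O y -> val x 0.
  move=> xy Ox Oy; exists 0%N, 0%N; split=> //; rewrite mul1r.
  by split; [exists y; rewrite ?xy|exists x; rewrite ?mul1r].
exists v; split.
- move=> x y ux uy; apply: (@val_uniq (x * y)); last exact: val_mul (vP x ux) (vP y uy).
  exact/vP/is_unitM.
- move=> x y xy Ox Oy; apply: (@val_uniq x); last exact: val0 xy Ox Oy.
  by apply: vP; exists y.
move=> v0; have [a [b [ab [tb _]]]] := vP t (ex_intro _ t' tt').
move: ab tb; rewrite v0 => ab; have -> : a = b by lia.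
rewrite -{2}[p ^+ b]mulr1 => /(divides_cancel (upX b))[c Oc eq].
apply: nOt'; suff -> : t' = c by [].
by rewrite -[t']mulr1 eq mulrA (mulrC t') tt' mul1r.
Qed.

End ValueGroup.

(** The subring [O1] obtained from [B] alone only serves to choose [t]: its preorder on
    the units has a least element [u] on [G], and for [t = 1/u] the subring generated
    by [B], [t] and the [t g] stays inside [O1], hence omits [u]. *)
Theorem exists_discrete_valuation B G : subring B -> noeth_subring B ->
  (forall x, algebra B G x) ->
  (forall g, g \in G -> exists2 h, h \in G & g * h = 1) ->
  ~ (exists s, forall x, span B s x) ->
  exists v : D -> int,
  [/\ forall x y, is_unit x -> is_unit y -> v (x * y) = v x + v y,
      forall x y, B x -> B y -> x * y = 1 -> v x = 0 &
      exists2 g, g \in G & v g <> 0].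
Proof.
move=> sB nB genG invG nfin.
(* no localisation at this first stage *)
pose E1 := eq (1 : D).
have mE1 : multset E1 by split=> // x y <- <-; rewrite mulr1.
have E1B x : E1 x -> B x by move=> <-; apply: subring1.
have [|O1 [sO1 BO1 _ [x0 nO1] tot1]] := exists_valuation_subring mE1 sB E1B genG.
  by case=> s fs; apply: nfin; exists s => x; have [_ <- ] := fs x; rewrite mul1r.
have uG g : g \in G -> is_unit g by move=> /invG[h _ gh]; exists h.
have [g0 g0G nO1g0] : exists2 g, g \in G & ~ O1 g.
  apply: contrapT => allG; apply: nO1; move: (genG x0); apply: algebra_min => // g gG.
  by apply: contrapT => ng; apply: allG; exists g.
have min (s : seq D) : {subset s <= G} ->
    exists2 u, u \in g0 :: s & {in g0 :: s, forall g, divides O1 u g}.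
  have rf := divides_refl sO1.
  elim: s => [|h s IH] sG.
    by exists g0; rewrite ?mem_head // => g; rewrite mem_seq1 => /eqP->; apply: rf.
  have [|u us uP] := IH; first by move=> g gs; apply: sG; rewrite inE gs orbT.
  have hG : h \in G by apply: sG; rewrite mem_head.
  have uu : is_unit u.
    move: us; rewrite inE => /predU1P[->|us]; apply: uG => //.
    by apply: sG; rewrite inE us orbT.
  have [uh|hu] := divides_total tot1 uu (uG h hG).
    exists u; first by move: us; rewrite !inE => /orP[->|->]; rewrite ?orbT.
    by move=> g; rewrite !inE orbCA => /predU1P[->//|gs]; apply: uP; rewrite inE.
  exists h; first by rewrite !inE eqxx orbT.
  move=> g; rewrite !inE orbCA => /predU1P[->|gs]; first exact: rf.
  by apply: (divides_trans sO1 hu); apply: uP; rewrite inE.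
have [u uG0 uP] : exists2 u, u \in G & {in G, forall g, divides O1 u g}.
  have [//|u us uP] := min G; exists u; last first.
    by move=> g gG; apply: uP; rewrite inE gG orbT.
  by move: us; rewrite inE => /predU1P[->|].
have nO1u : ~ O1 u.
  by move=> O1u; apply: nO1g0; have [c Oc ->] := uP g0 g0G; apply: subringM.
have [t tG ut] := invG u uG0.
have tu : t * u = 1 by rewrite mulrC.
have O1t : O1 t by have [/nO1u|] := tot1 u t ut.
have O1tg g : g \in G -> O1 (t * g).
  by move=> /uP[c Oc ->]; rewrite mulrA tu mul1r.
pose A := algebra B (t :: [seq t * g | g <- G]).
have sA : subring A by apply: algebra_subring.
have nA : noeth_subring A by apply: algebra_noeth.
have At : A t by apply: algebra_gen; rewrite ?mem_head.
have BA x : B x -> A x by apply: algebra_sub.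
have nAu : ~ A u.
  move=> Au; apply: nO1u; move: Au; apply: algebra_min => // g; rewrite inE.
  by move=> /predU1P[->//|/mapP[h hG ->]]; apply: O1tg.
have genA x : exists a, A (t ^+ a * x).
  move: (genG x).
  apply: (algebra_min (C := fun x => exists a, A (t ^+ a * x))).
  - split=> [|y z [a Aa] [b Ab]|y z [a Aa] [b Ab]].
    + by exists 0%N; rewrite mul1r; apply: subring1.
    + exists (a + b)%N; rewrite exprD.
      have -> : t ^+ a * t ^+ b * (y - z) =
          t ^+ b * (t ^+ a * y) - t ^+ a * (t ^+ b * z) by ring.
      by case: (sA) => _ AB AM; apply: AB; apply: AM => //; apply: subringX.
    + exists (a + b)%N; rewrite exprD mulrACA; exact: subringM.
  - by move=> y By; exists 0%N; rewrite mul1r; apply: BA.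
  - move=> g gG; exists 1%N; rewrite expr1; apply: algebra_gen => //.
    by rewrite inE map_f ?orbT.
have [|E [mE EA Et Emax]] := exists_maximal_multset sA At.
  move=> b Ab eq; apply: nAu; suff -> : u = b by [].
  by rewrite -[u]mulr1 eq mulrA ut mul1r.
have nfA : ~ finite_upto E A.
  case=> s fs.
  have [a aP] : exists a, {in s, forall z, A (t ^+ a * z)}.
    apply: uniform_bound => [i j x /subnK <-|x _]; last exact: genA.
    by rewrite exprD -mulrA => Ax; apply: subringM => //; apply: subringX.
  (* t ^ a clears the denominators of s, so the span of s cannot contain
     an element of E times u ^ (a + 1), that is, t ^ -(a + 1) *)
  have [f Ef Sf] := fs (u ^+ a.+1).
  suff Afu : A (f * u) by apply: (Et f _ Ef Afu); rewrite mulrCA tu mulr1.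
  have : A (t ^+ a * (f * u ^+ a.+1)).
    move: Sf; apply: (span_min (N := fun x => A (t ^+ a * x))) => //.
    exact: scaled_submod (submod_self sA).
  have -> : t ^+ a * (f * u ^+ a.+1) = f * u * (t ^+ a * u ^+ a) by rewrite exprS; ring.
  by rewrite -exprMn tu expr1n mulr1.
have [x|O [sO AO satO [x1 nOx1] totO]] :=
    @exists_valuation_subring _ E mE A [:: u] sA EA _ nfA.
  have [a Aa] := genA x; have -> : x = u ^+ a * (t ^+ a * x).
    by rewrite mulrA -exprMn ut expr1n mul1r.
  have sAA := submod_self sA.
  by apply: (adjoin_mulX sAA); apply: (adjoin_sub u sAA).
have genO x : exists a, O (t ^+ a * x) by have [a /AO] := genA x; exists a.
have nOu : ~ O u.
  move=> Ou; apply: nOx1; have [a Oa] := genO x1.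
  have -> : x1 = u ^+ a * (t ^+ a * x1) by rewrite mulrA -exprMn ut expr1n mul1r.
  by apply: subringM => //; apply: subringX.
have [e eP] := chain_bound sA mE EA tu nA At Emax sO AO genA.
have [v [vM v0 vt]] :=
  exists_valuation sA mE EA sO AO satO totO tu (AO t At) nOu genO eP.
exists v; split=> //; last by exists t.
by move=> x y /BA/AO Ox /BA/AO Oy xy; apply: (v0 x y).
Qed.

End Valuation.

(** * Noetherian modules and the lattice of row vectors *)

Section NoetherianModules.
Variables (T : comPzRingType) (V : lmodType T).
Implicit Types (N : V -> Prop) (s : seq V).

Definition lsub N : Prop :=
  [/\ N 0, forall x y, N x -> N y -> N (x + y) & forall c x, N x -> N (c *: x)].

Definition lspan s : V -> Prop :=
  fun x => forall N, lsub N -> {in s, forall y, N y} -> N x.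

Lemma lspan_sub s : lsub (lspan s).
Proof.
split=> [N [] //|x y Nx Ny N sN Ns|c x Nx N sN Ns].
  by case: (sN) => _ ND _; apply: ND; [apply: Nx|apply: Ny].
by case: (sN) => _ _; apply; apply: Nx.
Qed.

Lemma lspan_mem s x : x \in s -> lspan s x.
Proof. by move=> xs N _; apply. Qed.

Lemma lspan_subseq s1 s2 x : {subset s1 <= s2} -> lspan s1 x -> lspan s2 x.
Proof. by move=> s12; apply; [exact: lspan_sub|move=> y /s12; apply: lspan_mem]. Qed.

Lemma lsubB N x y : lsub N -> N x -> N y -> N (x - y).
Proof. by move=> [_ ND NZ] Nx Ny; apply: ND => //; rewrite -scaleN1r; apply: NZ. Qed.

Lemma lspan_sum s x : lspan s x -> exists c : 'I_(size s) -> T, x = \sum_i c i *: s`_i.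
Proof.
move/(_ (fun x => exists c : 'I_(size s) -> T, x = \sum_i c i *: s`_i)); apply.
  split=> [|y z [c ->] [d ->]|a y [c ->]].
  - by exists (fun=> 0); rewrite big1 // => i _; rewrite scale0r.
  - exists (fun i => c i + d i); rewrite -big_split.
    by apply: eq_bigr => i _; rewrite scalerDl.
  - exists (fun i => a * c i); rewrite scaler_sumr.
    by apply: eq_bigr => i _; rewrite scalerA.
move=> y ys; have lt_y : (index y s < size s)%N by rewrite index_mem.
exists (fun i => (i == Ordinal lt_y)%:R); rewrite (bigD1 (Ordinal lt_y)) //=.
rewrite eqxx scale1r nth_index // big1 ?addr0 // => i /negPf->.
by rewrite scale0r.
Qed.

Hypothesis nT : noeth_subring (fun _ : T => True).

(** Induction on the generators: the coefficients of [e0] in the elements of [N] form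
    an ideal, and the elements of [N] that lie in the span of the other generators
    are covered by the induction hypothesis. *)
Lemma noeth_submodule (e : seq V) N : lsub N -> (forall x, N x -> lspan e x) ->
  exists s, {in s, forall y, N y} /\ forall x, N x -> lspan s x.
Proof.
elim: e N => [|e0 e IH] N sN Ne.
  by exists [::].
have [E0 ED EZ] := lspan_sub e; have [N0 ND NZ] := sN.
pose I c := exists2 y, N y & lspan e (y - c *: e0).
have sI : submod (fun _ : T => True) I.
  split=> [|c d [y Ny ey] [z Nz ez]|b c _ [y Ny ey]].
  - by exists 0; rewrite ?scale0r ?subr0.
  - by exists (y + z); [exact: ND|rewrite scalerDl opprD addrACA; apply: ED].
  - by exists (b *: y); [exact: NZ|rewrite -scalerA -scalerBr; apply: EZ].
have [//|cs [csI Ics]] := nT sI.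
have /choice[f fP] : forall c, exists y, I c -> N y /\ lspan e (y - c *: e0).
  move=> c; have [[y Ny ey]|nI] := pselect (I c); first by exists y.
  by exists 0 => /nI.
have [|x [Nx ex]|s [sN' Ns]] := IH (fun x => N x /\ lspan e x).
- split=> // [x y [Nx ex] [Ny ey]|c x [Nx ex]].
    by split; [apply: ND|apply: ED].
  by split; [apply: NZ|apply: EZ].
- exact: ex.
exists (map f cs ++ s); split=> [y|x Nx].
  by rewrite mem_cat => /orP[/mapP[c /csI/fP[+ _] ->]|/sN'[]].
set gens := map f cs ++ s; have sG := lspan_sub gens; have [G0 GD GZ] := sG.
have [c ex] : exists c, lspan e (x - c *: e0).
  apply: (Ne x Nx (fun x => exists c, lspan e (x - c *: e0))).
    split=> [|y z [c ey] [d ez]|b y [c ey]].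
    - by exists 0; rewrite scale0r subr0.
    - by exists (c + d); rewrite scalerDl opprD addrACA; apply: ED.
    - by exists (b * c); rewrite -scalerA -scalerBr; apply: EZ.
  move=> y; rewrite inE => /predU1P[->|ye]; first by exists 1; rewrite scale1r subrr.
  by exists 0; rewrite scale0r subr0; apply: lspan_mem.
have [y [Ny Gy ey]] : exists y, [/\ N y, lspan gens y & lspan e (y - c *: e0)].
  pose P c := exists y, [/\ N y, lspan gens y & lspan e (y - c *: e0)].
  apply: (span_min (N := P) _ _ (Ics c _)).
  - split=> [|a b [y [Ny Gy ey]] [z [Nz Gz ez]]|b a _ [y [Ny Gy ey]]].
    + by exists 0; rewrite scale0r subr0.
    + exists (y + z); rewrite scalerDl opprD addrACA.
      by split; [exact: ND|exact: GD|exact: ED].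
    + exists (b *: y); rewrite -scalerA -scalerBr.
      by split; [exact: NZ|exact: GZ|exact: EZ].
  - move=> a acs; have [Nf ef] := fP a (csI a acs); exists (f a); split=> //.
    by apply: lspan_mem; rewrite mem_cat map_f.
  - by exists x.
rewrite -(subrK y x); apply: GD => //.
apply: lspan_subseq (Ns (x - y) _); first by move=> z zs; rewrite mem_cat zs orbT.
split; first exact: lsubB.
have -> : x - y = (x - c *: e0) - (y - c *: e0) by rewrite opprB addrA subrK.
exact: (lsubB (lspan_sub e)).
Qed.

Lemma noeth_sequence (e : seq V) (x : nat -> V) : (forall y, lspan e y) ->
  exists k, lspan [seq x i | i <- iota 0 k] (x k).
Proof.
move=> genV; pose S k := lspan [seq x i | i <- iota 0 k].
have Smono i j y : (i <= j)%N -> S i y -> S j y.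
  move=> lij; apply: lspan_subseq => _ /mapP[k ki ->]; apply: map_f.
  by move: ki; rewrite !mem_iota /= !add0n => /leq_trans; apply.
have [|//|s [sS Ss]] := @noeth_submodule e (fun y => exists k, S k y).
  split=> [|y z [i Sy] [j Sz]|c y [i Sy]].
  - by exists 0%N; case: (lspan_sub [seq x i | i <- iota 0 0]).
  - exists (maxn i j); case: (lspan_sub [seq x i | i <- iota 0 (maxn i j)]) => _ + _.
    by apply; [apply: Smono Sy; apply: leq_maxl|apply: Smono Sz; apply: leq_maxr].
  - by exists i; case: (lspan_sub [seq x i | i <- iota 0 i]) => _ _; apply.
have [k sk] := uniform_bound Smono sS.
exists k; apply: (Ss (x k) _ _ (lspan_sub _) sk).
by exists k.+1; apply: lspan_mem; apply: map_f; rewrite mem_iota /= add0n.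
Qed.

End NoetherianModules.

Lemma noeth_image (R D : comPzRingType) (f : {rmorphism R -> D}) :
  noetherian R -> noeth_subring (fun x : D => exists r, x = f r).
Proof.
move=> nR N [N0 ND NM] NB.
have [|m [e eP]] := nR (fun r => N (f r)).
  split; first by rewrite rmorph0.
    by move=> a b Na Nb; rewrite rmorphD; apply: ND.
  by move=> r a Na; rewrite rmorphM; apply: NM => //; exists r.
exists [seq f (e i) | i : 'I_m]; split=> [_ /mapP[i _ ->]|x Nx].
  apply/eP; exists (fun j => (j == i)%:R).
  rewrite (bigD1 i) //= eqxx mul1r big1 ?addr0 // => j /negPf->.
  by rewrite mul0r.
have [r xr] := NB x Nx; rewrite xr in Nx *; have /eP[c ->] := Nx.
rewrite rmorph_sum; set g := [seq _ | _ : _].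
have [S0 SD SM] := span_submod (fun x => exists r, x = f r) g.
apply: (big_ind (span (fun x => exists r, x = f r) g)) => // i _.
rewrite rmorphM; apply: SM; first by exists (c i).
by apply: span_mem; apply: map_f; rewrite mem_enum.
Qed.

Lemma image_subring (R D : comPzRingType) (f : {rmorphism R -> D}) :
  subring (fun x : D => exists r, x = f r).
Proof.
split=> [|_ _ [r ->] [s ->]|_ _ [r ->] [s ->]].
- by exists 1; rewrite rmorph1.
- by exists (r - s); rewrite rmorphB.
- by exists (r * s); rewrite rmorphM.
Qed.

Lemma int_noeth : noeth_subring (fun _ : int => True).
Proof.
move=> N sN _; have [N0 ND NM] := sN.
have [[a Na a0]|N00] := pselect (exists2 a, N a & a != 0); last first.
  exists [::]; split=> // x Nx; have [->|x0] := eqVneq x 0; last by case: N00; exists x.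
  by case: (span_submod (fun _ : int => True) [::]).
pose P k := `[< exists a, [/\ N a, a != 0 & `|a|%N = k] >].
have exP : exists k, P k by exists `|a|%N; apply/asboolP; exists a.
case: (ex_minnP exP) => k /asboolP[d [Nd d0 dk]] mink.
exists [:: d]; split=> [x|x Nx]; first by rewrite inE => /eqP->.
have Nr : N (x %% d)%Z.
  rewrite /modz -mulNr; apply: ND => //; exact: NM.
have [r0|rn0] := eqVneq (x %% d)%Z 0.
  rewrite (divz_eq x d) r0 addr0.
  case: (span_submod (fun _ : int => True) [:: d]) => _ _; apply => //.
  by apply: span_mem; rewrite mem_head.
have /mink : P `|x %% d|%Z%N by apply/asboolP; exists (x %% d)%Z.
by have := modz_ge0 x d0; have := ltz_mod x d0; lia.
Qed.

(** A combination [x_k] of the [x_i] with [i < k] becomes, multiplied by [A^k], a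
    relation [x_0 (1 - A s) = 0] where [s] commutes with [A].  If [x_0] is not zero,
    then [1 - A s] also kills a nonzero column [w], and [w = (A s)^k w] for all [k]. *)
Lemma no_infinite_division n (A : 'M[int]_n) (x : nat -> 'rV[int]_n) :
  (forall v : 'cV[int]_n,
     (forall k, (0 < k)%N -> exists w : 'cV[int]_n, v = A ^+ k *m w) -> v = 0) ->
  (forall k, x k.+1 *m A = x k) -> x 0%N = 0.
Proof.
move=> capA xA; have xAk k i : x (i + k)%N *m A ^+ k = x i.
  elim: k => [|k IH]; first by rewrite addn0 expr0 mulmx1.
  by rewrite addnS exprS -mulmxE mulmxA xA.
have x0A k : x k *m A ^+ k = x 0%N by apply: (xAk k 0%N).
have [|k xk] := @noeth_sequence int 'rV[int]_n int_noeth
    [seq delta_mx 0 i | i : 'I_n] x.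
  move=> y; rewrite (row_sum_delta y); set e := [seq _ | _ : _].
  have [E0 ED EZ] := lspan_sub e; apply: (big_ind (lspan e)) => // i _.
  by apply: EZ; apply: lspan_mem; apply: map_f; rewrite mem_enum.
have [s [sA xs]] : exists s : 'M[int]_n,
    A * s = s * A /\ x k *m A ^+ k = x 0%N *m (A * s).
  apply: (xk (fun y => exists s, A * s = s * A /\ y *m A ^+ k = x 0%N *m (A * s))).
    split=> [|y z [s [sA ys]] [r [rA zr]]|c y [s [sA ys]]].
    - by exists 0; rewrite mulr0 mul0r mul0mx mulmx0.
    - exists (s + r); rewrite mulmxDl ys zr -mulmxDr mulrDr; split=> //.
      by rewrite mulrDl sA rA.
    - exists (c *: s); rewrite -!mulmxE -scalemxAr -!scalemxAl -scalemxAr ys.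
      by split=> //; rewrite mulmxE sA.
  move=> _ /mapP[i + ->]; rewrite mem_iota /= add0n => lik.
  exists (A ^+ (k - i.+1)); split; first by rewrite -exprS -exprSr.
  rewrite -{1}(subnKC (ltnW lik)) exprD -mulmxE [LHS]mulmxA x0A.
  by rewrite mulmxE -exprS subnSK.
have xB : x 0%N *m (1 - A * s) = 0.
  by rewrite mulmxBr mulmx1 -xs x0A subrr.
apply/eqP; apply: contraT => x0.
have : \det (1 - A * s) == 0 by apply/det0P; exists (x 0%N).
rewrite -det_tr => /det0P[w w0 wB].
have wA : w^T = A *m s *m w^T.
  apply/eqP; rewrite -subr_eq0 -[X in X - _]mul1mx -mulmxBl.
  by rewrite -[X in X *m _]trmxK -trmx_mul wB trmx0.
case/negP: w0; rewrite -(inj_eq (@trmx_inj _ _ _)) trmx0.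
apply/eqP/capA => k' _; exists (s ^+ k' *m w^T).
rewrite mulmxA mulmxE -exprMn_comm //; elim: k' => [|k' IH]; first by rewrite mul1mx.
by rewrite exprSr -mulmxE -mulmxA mulmxE -mulmxE -wA.
Qed.

(** * Divisible monomials force finiteness *)

(** Here [psi] inverts the endomorphism that acts on monomials as [A], so the values
    [x_k j] of [psi^k (T e_j)] form an infinite sequence of successive divisions by
    [A]; its first term is not zero since the valuation is not zero on all the
    [T e_j]. *)
Theorem finite_of_contraction (D : comPzRingType) (B : D -> Prop) (n : nat)
    (A : 'M[int]_n) (T : 'cV[int]_n -> D) (psi : D -> D) :
  (forall v : 'cV[int]_n,
     (forall k, (0 < k)%N -> exists w : 'cV[int]_n, v = A ^+ k *m w) -> v = 0) ->
  subring B -> noeth_subring B ->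
  T 0 = 1 -> (forall u v, T (u + v) = T u * T v) ->
  (forall C, subring C -> (forall x, B x -> C x) -> (forall v, C (T v)) ->
     forall x, C x) ->
  psi 1 = 1 -> {morph psi : x y / x * y} -> (forall x, B x -> B (psi x)) ->
  (forall j, exists g h, [/\ B g, B h, g * h = 1 &
     T (delta_mx j 0) = psi (g * T (col j A))]) ->
  exists s, forall x, span B s x.
Proof.
move=> capA sB nB T0 TD genD psi1 psiM psiB psiT; apply: contrapT => nfin.
pose t j : D := T (delta_mx j 0); pose t' j : D := T (- delta_mx j 0).
have TN v : T v * T (- v) = 1 by rewrite -TD subrr.
pose G := [seq t j | j : 'I_n] ++ [seq t' j | j : 'I_n].
have tG j : t j \in G by rewrite mem_cat map_f // mem_enum.
have t'G j : t' j \in G by rewrite mem_cat orbC map_f // mem_enum.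
have genG x : algebra B G x.
  have sA := algebra_subring G sB.
  apply: genD => [//|y By|v]; first exact: algebra_sub.
  have -> : v = \sum_j v j 0 *: delta_mx j 0.
    by rewrite [LHS]matrix_sum_delta; apply: eq_bigr => j _; rewrite big_ord1.
  apply: (big_ind (fun v => algebra B G (T v))) => [|u w Tu Tw|j _].
  - by rewrite T0; apply: subring1.
  - by rewrite TD; apply: subringM.
  have TX (k : nat) (u : 'cV[int]_n) : T (k%:Z *: u) = T u ^+ k.
    by elim: k => [|k IH]; rewrite ?scale0r ?T0 // exprS -IH -TD intS scalerDl scale1r.
  case: (v j 0) => k.
    by rewrite TX; apply: subringX => //; apply: (algebra_gen sB (tG j)).
  rewrite NegzE scaleNr -scalerN TX; apply: subringX => //.
  exact: (algebra_gen sB (t'G j)).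
have invG g : g \in G -> exists2 h, h \in G & g * h = 1.
  rewrite mem_cat => /orP[] /mapP[j _ ->]; first by exists (t' j) => //; apply: TN.
  by exists (t j) => //; rewrite mulrC; apply: TN.
have [v [vM vB [g0 g0G vg0]]] := exists_discrete_valuation sB nB genG invG nfin.
have u1 : is_unit (1 : D) by exists 1; rewrite mulr1.
have v1 : v 1 = 0 by apply: (vB 1 1); rewrite ?mulr1 //; apply: subring1.
pose P k x := iter k psi x.
have P1 k : P k 1 = 1 by elim: k => //= k ->.
have PM k x y : P k (x * y) = P k x * P k y by elim: k => //= k ->.
have PB k x : B x -> B (P k x) by move=> Bx; elim: k => //= k; apply: psiB.
have Pu k u : is_unit (P k (T u)).
  by exists (P k (T (- u))); rewrite -PM TN P1.
pose c k u := v (P k (T u)).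
have cB k : zmod_morphism (c k).
  have cD x y : c k (x + y) = c k x + c k y.
    by rewrite /c TD PM vM; [|exact: Pu|exact: Pu].
  by move=> x y; apply/eqP; rewrite eq_sym subr_eq -cD subrK.
pose x k : 'rV[int]_n := \row_i c k (delta_mx i 0).
have cx k w : c k w = \sum_i x k 0 i * w i 0.
  pose f : {additive 'cV[int]_n -> int} :=
    HB.pack (c k) (GRing.isZmodMorphism.Build _ _ (c k) (cB k)).
  have -> : c k w = f w by [].
  rewrite [w in LHS]matrix_sum_delta raddf_sum; apply: eq_bigr => i _.
  rewrite big_ord1 mxE -[w i 0 in LHS]intz scaler_int raddfMz /=.
  by rewrite -mulrzr intz.
have xA k : x k.+1 *m A = x k.
  apply/rowP=> j; rewrite mxE [RHS]mxE.
  have -> : \sum_i x k.+1 0 i * A i j = c k.+1 (col j A).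
    by rewrite cx; apply: eq_bigr => i _; rewrite [col j A i 0]mxE.
  have [g [h [Bg Bh gh Tj]]] := psiT j; rewrite /c Tj.
  have -> : P k (psi (g * T (col j A))) = P k.+1 g * P k.+1 (T (col j A)).
    by rewrite -PM /P iterSr.
  have gu : P k.+1 g * P k.+1 h = 1 by rewrite -PM gh P1.
  rewrite vM //; last by exists (P k.+1 h).
  by rewrite (vB _ (P k.+1 h) (PB _ _ Bg) (PB _ _ Bh) gu) add0r.
have x0 := no_infinite_division capA xA.
have c0 w : c 0%N w = 0 by rewrite cx x0 big1 // => i _; rewrite mxE mul0r.
apply: vg0; move: g0G; rewrite mem_cat => /orP[] /mapP[j _ ->]; exact: c0.
Qed.

(** * Laurent polynomials *)

Section Laurent.
Variables (n : nat) (R : comPzRingType).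
Local Notation S := (laurent n R).

Definition lexp (u : 'cV[int]_n) : S := lmonom 1 u.

Lemma lexpD u v : lexp (u + v) = lexp u * lexp v.
Proof. by rewrite /lexp [RHS]lmulMM mulr1. Qed.

Lemma lexp_prod (I : Type) (r : seq I) (F : I -> 'cV[int]_n) :
  lexp (\sum_(i <- r) F i) = \prod_(i <- r) lexp (F i).
Proof. exact: (big_morph _ lexpD). Qed.

Lemma laurent_ind (C : S -> Prop) : subring C -> (forall r, C (laurentC r)) ->
  (forall u, C (lexp u)) -> forall p, C p.
Proof.
move=> sC CR CX p; rewrite (laurentE p); apply: big_ind => [|x y|u _].
- exact: subring0.
- exact: subringD.
suff -> : lmonom (monalg.mcoeff u p) u = laurentC (monalg.mcoeff u p) * lexp u.
  exact: subringM.
by rewrite [RHS]lmulMM mulr1 add0r.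
Qed.

Lemma laurent_noeth : noetherian R -> noeth_subring (fun _ : S => True).
Proof.
move=> nR; pose B (s : S) := exists r : R, s = laurentC r.
have sB : subring B by apply: image_subring.
pose G : seq S := [seq laurentX i 1 | i : 'I_n] ++ [seq laurentX i (-1) | i : 'I_n].
have sA := algebra_subring G sB.
have AT x : algebra B G x.
  move: x; apply: laurent_ind => // [r|u]; first by apply: algebra_sub => //; exists r.
  have -> : u = \sum_i u i 0 *: delta_mx i 0.
    by rewrite [LHS]matrix_sum_delta; apply: eq_bigr => j _; rewrite big_ord1.
  rewrite lexp_prod; apply: big_ind => [|x y|i _].
  - exact: subring1.
  - exact: subringM.
  have XX (z : int) (k : nat) : laurentX i (k%:Z * z) = laurentX i z ^+ k :> S.
    elim: k => [|k IH]; first by rewrite mul0r laurentX0.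
    by rewrite intS mulrDl mul1r laurentXD IH exprS.
  have -> : lexp (u i 0 *: delta_mx i 0) = laurentX i (u i 0) by [].
  case: (u i 0) => k.
    rewrite -[Posz k]mulr1 XX; apply: subringX => //; apply: algebra_gen => //.
    by rewrite mem_cat; apply/orP; left; apply/mapP; exists i; rewrite ?mem_enum.
  rewrite NegzE -mulrN1 XX; apply: subringX => //; apply: algebra_gen => //.
  by rewrite mem_cat; apply/orP; right; apply/mapP; exists i; rewrite ?mem_enum.
have nA : noeth_subring (algebra B G) by apply: algebra_noeth => //; apply: noeth_image.
move=> N [N0 ND NM] NT; have [|//|s [sN Ns]] := nA N.
  by split=> // b x _; apply: NM.
exists s; split=> // x /Ns; apply: span_mono.
by [].
Qed.
End Laurent.

(** * The quotient by the annihilator *)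

Section Annihilator.
Variables (S : comPzRingType) (M : lmodType S).

Definition annihilator : {pred S} := fun s => `[< forall x : M, s *: x = 0 >].

Lemma annihilatorP s : reflect (forall x : M, s *: x = 0) (s \in annihilator).
Proof. exact: asboolP. Qed.

Fact annihilator_zmod_closed : zmod_closed annihilator.
Proof.
split=> [|s r /annihilatorP sM /annihilatorP rM]; apply/annihilatorP => x.
  by rewrite scale0r.
by rewrite scalerBl sM rM subrr.
Qed.

HB.instance Definition _ :=
  GRing.isZmodClosed.Build S annihilator annihilator_zmod_closed.

(** Built by hand as a ring that may be trivial, which happens when [M] is. *)
Definition faithful_quotient : Type := Quotient.quot annihilator.
Local Notation Q := faithful_quotient.

HB.instance Definition _ := GRing.Zmodule.on Q.

Definition proj (s : S) : Q := (\pi_(Quotient.quot annihilator) s)%qT.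
Definition lift (q : Q) : S := repr (q : Quotient.quot annihilator).

Lemma liftK : cancel lift proj. Proof. exact: reprK. Qed.

Lemma proj_eq r s : proj r = proj s <-> forall x : M, r *: x = s *: x.
Proof.
split=> [|rs].
  move/eqP; rewrite -Quotient.idealrBE => /annihilatorP rs x.
  by apply/eqP; rewrite -subr_eq0 -scalerBl rs.
apply/eqP; rewrite -Quotient.idealrBE; apply/annihilatorP => x.
by rewrite scalerBl rs subrr.
Qed.

Lemma proj_is_zmod_morphism : zmod_morphism proj.
Proof. by move=> r s; rewrite /proj raddfB. Qed.

Definition qmul (p q : Q) : Q := proj (lift p * lift q).

Lemma lift_proj s (x : M) : lift (proj s) *: x = s *: x.
Proof. by have /proj_eq := liftK (proj s); apply. Qed.

Lemma projM r s : proj (r * s) = qmul (proj r) (proj s).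
Proof. by apply/proj_eq => x; rewrite -!scalerA !lift_proj. Qed.

Fact qmulA : associative qmul.
Proof. by move=> p q r; rewrite -(liftK p) -(liftK q) -(liftK r) -!projM mulrA. Qed.
Fact qmulC : commutative qmul.
Proof. by move=> p q; rewrite /qmul mulrC. Qed.
Fact qmul1 : left_id (proj 1) qmul.
Proof. by move=> q; rewrite -(liftK q) -projM mul1r. Qed.
Fact qmulDl : left_distributive qmul +%R.
Proof.
have projD r s : proj (r + s) = proj r + proj s by rewrite /proj raddfD.
move=> p q r; rewrite -(liftK p) -(liftK q) -(liftK r) -projD -!projM -projD.
by rewrite mulrDl.
Qed.

HB.instance Definition _ :=
  GRing.Zmodule_isComPzRing.Build Q qmulA qmulC qmul1 qmulDl.

HB.instance Definition _ :=
  GRing.isZmodMorphism.Build S Q proj proj_is_zmod_morphism.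

Fact proj_is_monoid_morphism : monoid_morphism proj.
Proof. by split=> // r s; apply: projM. Qed.

HB.instance Definition _ :=
  GRing.isMonoidMorphism.Build S Q proj proj_is_monoid_morphism.
End Annihilator.

(** * The endomorphism induced on the faithful quotient *)

(** The vector [F j s] lists the values of [eta^-j s eta^j] at the generators of [M].
    These values determine the endomorphism, which commutes with scalars.  The [F j s]
    form an increasing sequence of submodules of a power of [M]; where two consecutive
    ones agree, conjugating by [eta^j] gives [eta^-1 s eta = r] on [M]. *)
Lemma semilinear_surjective (S : comPzRingType) (phi : {rmorphism S -> S})
    (M : lmodType S) (eta : {additive M -> M}) :
  noeth_subring (fun _ : S => True) -> finite_module M -> bijective eta ->
  (forall s x, eta (s *: x) = phi s *: eta x) ->
  forall s, exists r, forall x : M, s *: x = phi r *: x.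
Proof.
move=> nS [m [e eP]] [theta etaK thetaK] etaZ s0.
have thetaZ s y : theta (phi s *: y) = s *: theta y.
  by apply: (can_inj etaK); rewrite thetaK etaZ thetaK.
have iZ k s y : iter k theta (iter k phi s *: y) = s *: iter k theta y.
  elim: k y => //= k IH y.
  by rewrite -iterS iterSr thetaZ IH -iterSr.
have iD k x y : iter k theta (x + y) = iter k theta x + iter k theta y.
  elim: k => //= k ->; by apply: (can_inj etaK); rewrite raddfD !thetaK.
have i0 k : iter k theta 0 = 0.
  by elim: k => //= k ->; apply: (can_inj etaK); rewrite thetaK raddf0.
pose F j s : {ffun 'I_m -> M} := [ffun i => iter j theta (s *: iter j eta (e i))].
have FS j s : F j s = F j.+1 (phi s).
  apply/ffunP=> i; rewrite !ffunE iterSr; congr iter.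
  by rewrite thetaZ /= etaK.
have FM j i s : (i <= j)%N -> exists r, F i s = F j r.
  move=> /subnKC <-; elim: (j - i)%N => [|k [r Fr]]; first by exists s; rewrite addn0.
  by exists (phi r); rewrite addnS -FS.
have subF j : lsub (fun f => exists s, f = F j s).
  split=> [|_ _ [r ->] [s ->]|c _ [s ->]].
  - by exists 0; apply/ffunP=> i; rewrite !ffunE scale0r i0.
  - by exists (r + s); apply/ffunP=> i; rewrite !ffunE scalerDl iD.
  - exists (iter j phi c * s); apply/ffunP=> i; rewrite !ffunE.
    by rewrite -scalerA iZ.
have [j Fj] : exists j, forall s, exists r, F j.+1 s = F j r.
  apply: contrapT => nF.
  have /choice[s sF] : forall j, exists s, forall r, F j.+1 s <> F j r.
    move=> j; apply: contrapT => nj; apply: nF; exists j => s; apply: contrapT => ns.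
    by apply: nj; exists s => r Fr; apply: ns; exists r.
  pose d (i k : 'I_m) : {ffun 'I_m -> M} := [ffun i' => if i' == i then e k else 0].
  pose gens := [seq d i k | i <- enum 'I_m, k <- enum 'I_m].
  have [|k Fk] := @noeth_sequence _ _ nS gens (fun j => F j.+1 (s j)).
    move=> f.
    have -> : f = \sum_i [ffun i' => if i' == i then f i else 0].
      apply/ffunP=> i; rewrite sum_ffunE (bigD1 i) //= big1 => [|i' /negPf i'i].
        by rewrite !ffunE eqxx addr0.
      by rewrite ffunE eq_sym i'i.
    have [G0 GD GZ] := lspan_sub gens.
    apply: (big_ind (lspan gens)) => // i _; have [c ->] := eP (f i).
    have -> : [ffun i' => if i' == i then \sum_(k < m) c k *: e k else 0] =
        \sum_k c k *: d i k.
      apply/ffunP=> i'; rewrite sum_ffunE ffunE; case: eqP => ii'.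
        by apply: eq_bigr => k _; rewrite !ffunE ii' eqxx.
      by rewrite big1 // => k _; rewrite !ffunE; case: eqP => // _; rewrite scaler0.
    apply: (big_ind (lspan gens)) => // k _; apply: GZ; apply: lspan_mem.
    by apply/allpairsP; exists (i, k); rewrite !mem_enum.
  have [r] : exists r, F k.+1 (s k) = F k r.
    apply: (Fk _ (subF k)) => _ /mapP[i + ->]; rewrite mem_iota /= add0n => lik.
    exact: FM.
  exact: sF.
have [r Fr] := Fj s0; exists r => x.
have iE k c y : iter k eta (c *: y) = iter k phi c *: iter k eta y.
  by elim: k => //= k ->; rewrite etaZ.
have iEsum k (f : 'I_m -> M) : iter k eta (\sum_i f i) = \sum_i iter k eta (f i).
  by elim: k => //= k ->; rewrite raddf_sum.
have iTsum k (f : 'I_m -> M) : iter k theta (\sum_i f i) = \sum_i iter k theta (f i).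
  exact: (big_morph _ (iD k) (i0 k)).
have E y : iter j.+1 theta (s0 *: iter j.+1 eta y) = iter j theta (r *: iter j eta y).
  have [c ->] := eP y; rewrite !iEsum !scaler_sumr !iTsum; apply: eq_bigr => i _.
  have /ffunP/(_ i) := Fr; rewrite !ffunE => Fri.
  rewrite !iE !scalerA !(mulrC _ (iter _ phi (c i))) -!scalerA !iZ.
  by rewrite Fri.
have iTK k : cancel (iter k theta) (iter k eta).
  by elim: k => // k IH y; rewrite iterSr [iter _ theta _]iterS thetaK IH.
have /(congr1 (iter j eta)) := E (iter j theta (theta x)).
rewrite iterSr !iTK iterS iTK thetaK => /(congr1 eta).
by rewrite thetaK etaZ thetaK.
Qed.

Lemma finite_quotient (n : nat) (A : 'M[int]_n) (R : comPzRingType)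
    (phi : {rmorphism laurent n R -> laurent n R}) (g : 'I_n -> R)
    (D : comPzRingType) (pr : {rmorphism laurent n R -> D}) :
  (forall v : 'cV[int]_n,
     (forall k, (0 < k)%N -> exists w : 'cV[int]_n, v = A ^+ k *m w) -> v = 0) ->
  noetherian R ->
  (forall r : R, exists r', laurentC r = phi (laurentC r')) ->
  (forall j, is_unit (g j)) ->
  (forall j, phi (laurentX j 1) =
     laurentC (g j) * \prod_(i < n) laurentX i (A i j)) ->
  (forall d, exists s, d = pr s) ->
  (forall s r, pr (phi s) = pr (phi r) -> pr s = pr r) ->
  (forall s, exists r, pr s = pr (phi r)) ->
  exists s, forall x, span (fun d => exists r, d = (pr \o laurentC) r) s x.
Proof.
move=> capA noethR phiR g_unit phiX pr_surj phi_mod surj.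
pose iota : {rmorphism R -> D} := pr \o laurentC.
pose B (x : D) := exists r, x = iota r.
pose T (v : 'cV[int]_n) : D := pr (lexp R v).
have /choice[f fP] : forall d : D, exists s, d = pr (phi s).
  by move=> d; have [s ->] := pr_surj d; apply: surj.
pose psi d := pr (f d).
have psiE s : psi (pr (phi s)) = pr s by apply: phi_mod; rewrite -fP.
have psiM x y : psi (x * y) = psi x * psi y.
  have -> : x * y = pr (phi (f x * f y)) by rewrite !rmorphM -!fP.
  by rewrite psiE rmorphM.
have psi1 : psi 1 = 1.
  have -> : 1 = pr (phi 1) by rewrite !rmorph1.
  by rewrite psiE !rmorph1.
apply: (@finite_of_contraction D B n A T psi) => //.
- exact: image_subring.
- exact: noeth_image.
- exact: rmorph1.
- by move=> u v; rewrite /T lexpD rmorphM.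
- move=> C sC BC TC x; have [s ->] := pr_surj x; move: s.
  apply: (laurent_ind (C := fun s => C (pr s))) => [|r|//]; last by apply: BC; exists r.
  case: sC => C1 CB CM; split=> [|s r Cs Cr|s r Cs Cr].
  + by rewrite rmorph1.
  + by rewrite rmorphB; apply: CB.
  + by rewrite rmorphM; apply: CM.
- move=> _ [r ->]; have [r' e] := phiR r.
  by exists r'; rewrite /iota /= e psiE.
move=> j; have [h gh] := g_unit j; exists (iota (g j)), (iota h); split.
- by exists (g j).
- by exists h.
- by rewrite -rmorphM gh rmorph1.
have -> : col j A = \sum_i A i j *: delta_mx i 0.
  by rewrite [LHS]matrix_sum_delta; apply: eq_bigr => i _; rewrite big_ord1 mxE.
rewrite /T lexp_prod -[iota (g j)]/(pr (laurentC (g j))) -rmorphM -(phiX j) psiE.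
by rewrite /laurentX scale1r.
Qed.

Theorem theorem17 (n : nat) (A : 'M[int]_n)
  (detA : \det A != 0)
  (capA : forall v : 'cV[int]_n,
    (forall k : nat, (0 < k)%N -> exists w : 'cV[int]_n, v = A ^+ k *m w)
    <-> v = 0)
  (R : comPzRingType) (noethR : noetherian R)
  (phi : {rmorphism laurent n R -> laurent n R})
  (phi_inj : injective phi)
  (phiR : forall s : laurent n R,
    (exists r : R, s = phi (laurentC r)) <-> (exists r : R, s = laurentC r))
  (g : 'I_n -> R) (g_unit : forall j, is_unit (g j))
  (phiX : forall j : 'I_n,
    phi (laurentX j 1) =
      laurentC (g j) * \prod_(i < n) laurentX i (A i j))
  (M : lmodType (laurent n R)) (finM : finite_module M)
  (eta : {additive M -> M}) (eta_bij : bijective eta)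
  (eta_semilin : forall (s : laurent n R) (x : M),
    eta (s *: x) = phi s *: eta x) :
  finite_module (restrict_scalars (@laurentC n R) M).
Proof.
have nS := @laurent_noeth n R noethR.
have surj := semilinear_surjective nS finM eta_bij eta_semilin.
have capA' v := (capA v).1.
have phiR' (r : R) : exists r', laurentC r = phi (laurentC r').
  by apply/phiR; exists r.
have proj_surj (d : faithful_quotient M) : exists s, d = proj M s.
  by exists (lift d); rewrite liftK.
have phi_mod s r : proj M (phi s) = proj M (phi r) -> proj M s = proj M r.
  move=> /proj_eq e; apply/proj_eq => x; apply: (bij_inj eta_bij).
  by rewrite !eta_semilin.
have proj_phi s : exists r, proj M s = proj M (phi r).
  by have [r e] := surj s; exists r; apply/proj_eq.
have [s0 Ds0] :=
  finite_quotient capA' noethR phiR' g_unit phiX proj_surj phi_mod proj_phi.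
have [m [e eP]] := finM.
pose D := faithful_quotient M; pose N := restrict_scalars (@laurentC n R) M.
pose gens : seq N := [seq (lift d *: e i : M) | d <- s0, i <- enum 'I_m].
have [G0 GD GZ] := lspan_sub gens.
have genM (x : N) : lspan gens x.
  have [c ->] := eP x; apply: (big_ind (lspan gens)) => // i _.
  have : forall d : D, lspan gens (lift d *: e i : M).
    pose P (d : D) := lspan gens (lift d *: e i : M).
    move=> d; apply: (span_min (N := P) _ _ (Ds0 d)).
    - split=> [|x1 x2 G1 G2|_ x1 [r ->] G1].
      + by rewrite /P -(rmorph0 (proj M)) lift_proj scale0r.
      + rewrite /P -(liftK x1) -(liftK x2) -(rmorphD (proj M)) lift_proj scalerDl.
        exact: GD.
      + rewrite /P -(liftK x1) -(rmorphM (proj M)) lift_proj -scalerA.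
        exact: (GZ r).
    - move=> d' d's; apply: lspan_mem; apply/allpairsP; exists (d', i).
      by rewrite mem_enum.
  by move=> /(_ (proj M (c i))); rewrite lift_proj.
exists (size gens), (fun i => gens`_i) => x; exact: lspan_sum (genM x).
Qed.
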